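(* Let $p\ge1$ and let $\pi,\hat\pi$ be probability distributions on $\mathbb{R}^d$ with $\pi\ll\hat\pi$. Then $$W_p(\hat\pi,\pi)\le C^{\mathrm{PI}}_{2p}(\hat\pi)\,\big[\exp\{D_2(\pi\mid\hat\pi)\}-1\big]^{\frac1{2p}}$$ and $$W_p(\hat\pi,\pi)\le C^{\mathrm{EI}}_{p}(\hat\pi)\Big[\mathrm{KL}(\pi\mid\hat\pi)^{\frac1p}+\{\mathrm{KL}(\pi\mid\hat\pi)/2\}^{\frac1{2p}}\Big].$$
   Context: All distributions are Borel probability measures on $\mathbb{R}^d$; $\mu\ll\nu$ denotes absolute continuity. Quantities take values in $[0,\infty]$, with the convention $0\cdot\infty=0$. $W_p(\xi,\pi)=\inf_{\gamma}\{\int\|\theta-\theta'\|_2^p\,\gamma(d\theta,d\theta')\}^{1/p}$, the infimum being over couplings $\gamma$ of $\xi$ and $\pi$. For $r\ge1$: $C^{\mathrm{PI}}_{r}(\xi)=2\inf_{\theta_0\in\mathbb{R}^d}\{\int\|\theta-\theta_0\|_2^{r}\,\xi(d\theta)\}^{1/r}$ and $C^{\mathrm{EI}}_{r}(\xi)=2\inf_{\theta_0\in\mathbb{R}^d,\,\epsilon>0}\big[\frac1\epsilon\{\frac32+\log\int e^{\epsilon\|\theta-\theta_0\|_2^{r}}\xi(d\theta)\}\big]^{1/r}$. $\mathrm{KL}(\pi\mid\xi)=\int\log\big(\frac{d\pi}{d\xi}\big)d\pi$ and $D_2(\pi\mid\xi)=\log\int\frac{d\pi}{d\xi}\,d\pi$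 for $\pi\ll\xi$. *)

(* Defs.v *)
From HB Require Import structures.
From mathcomp Require Import all_boot all_order all_algebra.
From mathcomp Require Import all_classical all_reals all_analysis.

Set Implicit Arguments.
Unset Strict Implicit.
Unset Printing Implicit Defensive.

Import Order.TTheory GRing.Theory Num.Theory.
Import numFieldNormedType.Exports.

Local Open Scope classical_set_scope.
Local Open Scope ring_scope.
Local Open Scope ereal_scope.
Local Open Scope charge_scope.

Definition borelRn (R : realType) (d : nat) : measurableType _ :=
  g_sigma_algebraType (@open 'rV[R]_d).

(* The library norm `|x| on 'rV[R]_d is the sup norm, so the Euclidean
   distance is spelled out. *)
Definition dist2 (R : realType) (d : nat) (x y : 'rV[R]_d) : R :=
  Num.sqrt (\sum_(i < d) (x ord0 i - y ord0 i) ^+ 2)%R.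

Section distances.
Context {R : realType} {d : nat}.
Local Notation E := (borelRn R d).
Implicit Types (xi pi : probability E R) (p r : R).

Definition coupling xi pi : set (probability (E * E)%type R) :=
  [set g | (forall A : set E, measurable A -> g (fst @^-1` A) = xi A) /\
           (forall B : set E, measurable B -> g (snd @^-1` B) = pi B)].

Definition wasserstein p xi pi : \bar R :=
  ereal_inf [set (\int[g]_z (dist2 z.1 z.2 `^ p)%:E) `^ p^-1
            | g in coupling xi pi].

Definition C_PI r xi : \bar R :=
  2%:E * ereal_inf [set (\int[xi]_t (dist2 t t0 `^ r)%:E) `^ r^-1
                   | t0 in [set: E]].

Definition C_EI r xi : \bar R :=
  2%:E * ereal_inf
    [set (((te.2)^-1)%:E *
           ((3 / 2)%:E
            + lne (\int[xi]_t (expR (te.2 * dist2 t te.1 `^ r))%:E))) `^ r^-1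
    | te in [set te : E * R | (0 < te.2)%R]].

(* KL and D2 are meaningful only for pi `<< xi, as the library derivative
   is a junk value otherwise. *)
Definition dRN pi xi : E -> \bar R := 'd (charge_of_finite_measure pi) '/d xi.

Definition KL pi xi : \bar R := \int[pi]_t lne (dRN pi xi t).

Definition D2 pi xi : \bar R := lne (\int[pi]_t dRN pi xi t).

End distances.

(* Main.v *)
(** The coupling that keeps the shared mass [min(g, 1)], [g = dpi/dnu], in
   place and couples the two remainders independently gives
   [W_p^p <= 2^(p-1) \int d(x, t)^p |g - 1| dnu] for every centre [t].  The
   first bound is then the Cauchy-Schwarz inequality.  For the second one, put
   [phi = eps d(x, t)^p], [L = log \int e^phi dnu] and
   [h(u) = u log u - u + 1], and split [phi <= L + (phi - L)^+].  The bounded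
   part is handled by the linearized Pinsker inequality
   [|u - 1| <= h(u) / s + s (u + 2) / 6], the excess [x = (phi - L)^+] by Young's
   inequality [s x |u - 1| <= h(u) + e^(s x) - 1 - s x] together with
   [e^(s x) - 1 - s x <= s^2 e^x].  Integrating and optimizing over both
   parameters gives
   [\int phi |g - 1| dnu <= 2 (3/2 + L) (KL + sqrt (KL / 2))], and the [p]-th
   root is subadditive. *)
From HB Require Import structures.
Require Import Defs.
From mathcomp Require Import all_boot all_order all_algebra.
From mathcomp Require Import all_classical all_reals all_analysis.
From mathcomp Require Import measurable_realfun ring lra.

Set Implicit Arguments.
Unset Strict Implicit.
Unset Printing Implicit Defensive.

Import Order.TTheory GRing.Theory Num.Theory.
Import numFieldNormedType.Exports.

Local Open Scope classical_set_scope.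
Local Open Scope ring_scope.

(** * Scalar inequalities *)

(* The affine term makes the integrand nonnegative; against a probability
   density it integrates to zero. *)
Definition rel_entr (R : realType) (u : R) : R := u * ln u - u + 1.

Lemma derive_ge0_le (R : realType) (f df : R -> R) (a b : R) : a <= b ->
  (forall x, a <= x <= b -> is_derive x 1 f (df x)) ->
  (forall x, a < x < b -> 0 <= df x) -> f a <= f b.
Proof.
move=> ab fdf df0; rewrite -subr_ge0; have [->|nab] := eqVneq a b.
  by rewrite subrr.
have {nab} altb : a < b by rewrite lt_neqAle nab.
have [||c cab ->] := @MVT R f df a b altb.
- by move=> x; rewrite in_itv/= => /andP[ax xb]; apply: fdf; rewrite !ltW.
- apply: derivable_within_continuous => x; rewrite in_itv/= => xab.
  by have [] := fdf x xab.
- rewrite mulr_ge0 ?subr_ge0// df0//; by rewrite in_itv in cab.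
Qed.

Lemma derive_le0_le (R : realType) (f df : R -> R) (a b : R) : a <= b ->
  (forall x, a <= x <= b -> is_derive x 1 f (df x)) ->
  (forall x, a < x < b -> df x <= 0) -> f b <= f a.
Proof.
move=> ab fdf df0; rewrite -lerN2.
apply: (@derive_ge0_le _ (fun x => - f x) (fun x => - df x)) => //.
- by move=> x /fdf ?; exact: is_deriveN.
- by move=> x /df0; rewrite oppr_ge0.
Qed.

(** The rational function is what results from solving [pinsker_pointwise] for [ln u]. The
    difference [F] vanishes at 1 and its derivative has the sign of [x - 1], so its minimum is at
    1. *)
Lemma ln_ge_pade (R : realType) (u : R) : 0 < u ->
  (u - 1) * (5 * u + 1) / (2 * u * (u + 2)) <= ln u.
Proof.
move=> u0.
pose F (x : R) := ln x - (x - 1) * (5 * x + 1) * (2 * x * (x + 2))^-1.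
pose dF (x : R) := (x - 1) ^+ 3 / (x ^+ 2 * (x + 2) ^+ 2).
have dFP (x : R) : 0 < x -> is_derive x 1 F (dF x).
  move=> x0; have x20 : 2 * x * (x + 2) != 0 by rewrite !mulf_neq0// gt_eqF//; lra.
  have := is_derive1_ln x0 => ?.
  have ? : is_derive x 1 (fun x => (2 * x * (x + 2))^-1)
     (- (2 * x * (x + 2)) ^- 2 *: (4 * x + 4)).
    apply: is_deriveV => //.
    apply: is_derive_eq; rewrite /= /GRing.scale/=; ring.
  apply: is_derive_eq.
  rewrite /dF /GRing.scale/=; field.
  by rewrite !gt_eqF//; lra.
have F1 : F 1 = 0 by rewrite /F ln1 subrr mul0r mul0r subrr.
suff : 0 <= F u by rewrite subr_ge0.
rewrite -F1; have [u1|/ltW u1] := leP u 1.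
- apply: (@derive_le0_le _ F dF) => // [x /andP[ux _]|x /andP[ux x1]].
    by apply: dFP; lra.
  rewrite /dF mulr_le0_ge0//; last first.
    by rewrite invr_ge0 mulr_ge0// sqr_ge0.
  by rewrite exprS mulr_le0_ge0 ?sqr_ge0// subr_le0 ltW.
- apply: (@derive_ge0_le _ F dF) => // [x /andP[ux _]|x /andP[ux x1]].
    by apply: dFP; lra.
  rewrite /dF divr_ge0//; last by rewrite mulr_ge0// sqr_ge0.
  by rewrite exprn_ge0// subr_ge0 ltW.
Qed.

Lemma pinsker_pointwise (R : realType) (u : R) : 0 <= u ->
  3 * (u - 1) ^+ 2 <= (2 * u + 4) * rel_entr u.
Proof.
rewrite le_eqVlt => /predU1P[<-|u0]; first by rewrite /rel_entr mul0r; lra.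
have := ln_ge_pade u0; rewrite ler_pdivrMr; last by rewrite !mulr_gt0//; lra.
rewrite /rel_entr; set l := ln u; nra.
Qed.

Lemma rel_entr_ge0 (R : realType) (u : R) : 0 <= u -> 0 <= rel_entr u.
Proof.
move=> u0; have := pinsker_pointwise u0 => h.
rewrite -(@pmulr_rge0 _ (2 * u + 4)); last lra.
by apply: le_trans h; rewrite mulr_ge0// sqr_ge0.
Qed.

(** AM-GM: by [pinsker_pointwise], [(u - 1)^2] is at most four times the product of the two
    summands. The free [t] postpones the optimization until after integration. *)
Lemma abs_sub1_le_rel_entr (R : realType) (u t : R) : 0 <= u -> 0 < t ->
  `|u - 1| <= rel_entr u / t + t * (u + 2) / 6.
Proof.
move=> u0 t0; have := pinsker_pointwise u0; have := rel_entr_ge0 u0.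
set h := rel_entr u => h0 hu.
have k0 : 0 <= h / t + t * (u + 2) / 6.
  by rewrite addr_ge0 ?divr_ge0 ?mulr_ge0//; lra.
rewrite -ler_sqr ?nnegrE ?normr_ge0// real_normK ?num_real//.
have -> : (h / t + t * (u + 2) / 6) ^+ 2 =
  (h / t - t * (u + 2) / 6) ^+ 2 + (2 * u + 4) * h / 3 by field; rewrite gt_eqF.
have := sqr_ge0 (h / t - t * (u + 2) / 6); lra.
Qed.

(** Fenchel-Young: [expR s - 1] is the convex conjugate of [rel_entr] on the half-line. For [u > 0]
    it is [1 + y <= expR y] at [y = s - ln u], multiplied by [u]. *)
Lemma rel_entr_young (R : realType) (u s : R) : 0 <= u ->
  s * (u - 1) <= rel_entr u + expR s - 1 - s.
Proof.
rewrite le_eqVlt => /predU1P[<-|u0].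
  by rewrite /rel_entr mul0r; have := expR_ge0 s; lra.
have := expR_ge1Dx (s - ln u); rewrite expRD expRN lnK ?posrE//.
rewrite ler_pdivlMr// /rel_entr; set l := ln u; nra.
Qed.

Lemma expR_ge_quadratic (R : realType) (s : R) : 0 <= s ->
  1 + s + s ^+ 2 / 2 <= expR s.
Proof.
move=> s0; rewrite -subr_ge0.
pose f (y : R) := expR y - (1 + y + y ^+ 2 / 2).
have <- : f 0 = 0 by rewrite /f expR0; ring.
apply: (@derive_ge0_le _ f (fun y => expR y - (1 + y))) => //.
- by move=> y _; apply: is_derive_eq; rewrite /GRing.scale/=; field.
- by move=> y _; rewrite subr_ge0 expR_ge1Dx.
Qed.

(** For [u < 1] both sides of Young's inequality dominate squares, [(1 - u)^2 / 2 <= rel_entr u] and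
    [s^2 / 2 <= expR s - 1 - s], and AM-GM concludes. *)
Lemma rel_entr_young_abs (R : realType) (u s : R) : 0 <= u -> 0 <= s ->
  s * `|u - 1| <= rel_entr u + expR s - 1 - s.
Proof.
move=> u0 s0; have [u1|u1] := leP 1 u.
  by rewrite ger0_norm ?subr_ge0// rel_entr_young.
rewrite ltr0_norm ?subr_lt0//; have := pinsker_pointwise u0.
have := rel_entr_ge0 u0; have := expR_ge_quadratic s0.
set h := rel_entr u => es h0 hu.
have : (u - 1) ^+ 2 <= 2 * h by nra.
have := sqr_ge0 (s - (1 - u)); nra.
Qed.

(** In the power series this is [t^k <= t^2] for [k >= 2]. The proof differentiates twice; [step]
    gives the sign of the first derivative. *)
Lemma expR_sub_quadratic (R : realType) (t x : R) : 0 <= t <= 1 -> 0 <= x ->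
  expR (t * x) - 1 - t * x <= t ^+ 2 * (expR x - 1 - x).
Proof.
move=> /andP[t0 t1].
have step (y : R) : 0 <= y -> 0 <= t * (expR y - 1) - (expR (t * y) - 1).
  move=> y0; pose f z := t * (expR z - 1) - (expR (t * z) - 1).
  have <- : f 0 = 0 by rewrite /f !mulr0 expR0; ring.
  apply: (@derive_ge0_le _ f (fun z => t * (expR z - expR (t * z)))) => //.
  - by move=> z _; apply: is_derive_eq; rewrite /GRing.scale/=; ring.
  - move=> z /andP[z0 _]; rewrite mulr_ge0// subr_ge0 ler_expR.
    by rewrite ler_piMl// ltW.
move=> x0; rewrite -subr_ge0.
pose f y := t ^+ 2 * (expR y - 1 - y) - (expR (t * y) - 1 - t * y).
have <- : f 0 = 0 by rewrite /f !mulr0 expR0; ring.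
apply: (@derive_ge0_le _ f
  (fun y => t * (t * (expR y - 1) - (expR (t * y) - 1)))) => //.
- by move=> y _; apply: is_derive_eq; rewrite /GRing.scale/=; ring.
- by move=> y /andP[y0 _]; rewrite mulr_ge0// step// ltW.
Qed.

(** The right-hand side is built to be integrated: [u] becomes a density of mass 1, and
    [expR (phi - L)] has integral 1 when [L] is the logarithm of the exponential moment of [phi]. *)
Lemma weighted_pinsker_pointwise (R : realType) (u phi L t1 t2 : R) :
  0 <= u -> 0 <= phi -> 0 <= L -> 0 < t1 -> 0 < t2 <= 1 ->
  phi * `|u - 1| <= (L / t1 + t2^-1) * rel_entr u + L * t1 / 6 * (u + 2)
                    + t2 * expR (phi - L).
Proof.
move=> u0 phi0 L0 t10 /andP[t20 t21].
have h0 := rel_entr_ge0 u0.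
have p1 : L * `|u - 1| <= L / t1 * rel_entr u + L * t1 / 6 * (u + 2).
  have -> : L / t1 * rel_entr u + L * t1 / 6 * (u + 2) =
      L * (rel_entr u / t1 + t1 * (u + 2) / 6) by field; rewrite gt_eqF.
  by rewrite ler_wpM2l// abs_sub1_le_rel_entr.
rewrite mulrDl; move: p1.
set A := L / t1 * _; set B := L * t1 / 6 * _ => p1.
have [phiL|/ltW phiL] := leP phi L.
  apply: (@le_trans _ _ (L * `|u - 1|)); first by rewrite ler_wpM2r.
  apply: (le_trans p1).
  have k1 : 0 <= t2^-1 * rel_entr u by rewrite mulr_ge0// invr_ge0 ltW.
  have k2 : 0 <= t2 * expR (phi - L) by rewrite mulr_ge0 ?expR_ge0// ltW.
  by move: k1 k2; set D := t2^-1 * rel_entr u; set F := t2 * _; lra.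
set c := phi - L; have c0 : 0 <= c by rewrite subr_ge0.
(* Young's inequality with parameter [t2 * c], divided by [t2]. The exponential remainder is
   quadratic in [t2], so one factor [t2] survives in front of it. *)
have p2 : c * `|u - 1| <= t2^-1 * rel_entr u + t2 * expR c.
  have tc0 : 0 <= t2 * c by rewrite mulr_ge0// ltW.
  have y := rel_entr_young_abs u0 tc0.
  have q : expR (t2 * c) - 1 - t2 * c <= t2 ^+ 2 * (expR c - 1 - c).
    by apply: expR_sub_quadratic => //; rewrite t21 ltW.
  have e : t2 * (c * `|u - 1|) <= rel_entr u + t2 ^+ 2 * expR c.
    have : 0 <= t2 ^+ 2 * (1 + c) by rewrite mulr_ge0 ?sqr_ge0//; lra.
    lra.
  rewrite -(ler_pM2l t20); apply: (le_trans e).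
  by rewrite mulrDr !mulrA divff ?gt_eqF// mul1r expr2.
rewrite [X in X * _](_ : phi = L + c); last by rewrite /c; ring.
by rewrite mulrDl; move: p1 p2; set D := t2^-1 * rel_entr u; lra.
Qed.

(** On [[0, 1]] one has [s <= s^q]; this is applied to the fractions [x / (x + y)] and
    [y / (x + y)], which sum to 1. *)
Lemma powR_subadditive (R : realType) (x y q : R) : 0 <= x -> 0 <= y ->
  0 < q <= 1 -> (x + y) `^ q <= x `^ q + y `^ q.
Proof.
move=> x0 y0 /andP[q0 q1]; have [s0|s0] := eqVneq (x + y) 0.
  by rewrite s0 powR0 ?gt_eqF// addr_ge0 ?powR_ge0.
have {}s0 : 0 < x + y by rewrite lt_neqAle eq_sym s0 addr_ge0.
have key z : 0 <= z -> z <= x + y -> z / (x + y) * (x + y) `^ q <= z `^ q.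
  move=> z0 zs; have d0 : 0 <= z / (x + y) by rewrite divr_ge0// ltW.
  rewrite -[in leRHS](@divfK _ (x + y) _ z) ?gt_eqF// powRM// ?(ltW s0)//.
  rewrite ler_wpM2r ?powR_ge0//; have [z'|z'] := eqVneq (z / (x + y)) 0.
    by rewrite z' powR_ge0.
  rewrite -[X in X <= _]powRr1//; apply: ger_powR => //.
  by rewrite lt_neqAle eq_sym z' d0/= ler_pdivrMr// mul1r.
have -> : (x + y) `^ q = x / (x + y) * (x + y) `^ q + y / (x + y) * (x + y) `^ q.
  by rewrite -mulrDl -mulrDl divff ?gt_eqF// mul1r.
by rewrite lerD// key// ?lerDl ?lerDr.
Qed.

(** Convexity of the power at the midpoint of [x] and [y]. *)
Lemma powR_addr_le (R : realType) (x y p : R) : 0 <= x -> 0 <= y -> 1 <= p ->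
  (x + y) `^ p <= 2 `^ (p - 1) * (x `^ p + y `^ p).
Proof.
move=> x0 y0 p1; have h0 : 0 <= (2^-1 : R) by lra.
have h1 : (2^-1 : R) <= 1 by lra.
have := @convex_powR R p p1 (Itv01 h0 h1) x y.
rewrite !inE/= !in_itv/= !andbT x0 y0 => /(_ isT isT); rewrite !convRE/=.
rewrite /unstable.onem => h.
have {h} : (2^-1 * x + (1 - 2^-1) * y) `^ p <=
    2^-1 * x `^ p + (1 - 2^-1) * y `^ p := h.
have -> : 2^-1 * x + (1 - 2^-1) * y = (x + y) * 2^-1 by lra.
have -> : 2^-1 * x `^ p + (1 - 2^-1) * y `^ p = (x `^ p + y `^ p) * 2^-1 by lra.
have p20 : 0 < 2 `^ p :> R by rewrite powR_gt0.
rewrite powRM ?addr_ge0// -powR_inv1// -powRrM mulN1r powRN.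
rewrite ler_pdivrMr// => /le_trans; apply.
rewrite powRB ?pnatr_eq0 ?implybT// powRr1// powR_inv1//; lra.
Qed.

(* The choices are [t1 = 2 r] with [r = sqrt (K / 2)], and [t2 = min(sqrt K, 1)]
   with [sqrt K = sqrt 2 * r] rounded to [7/5 * r]. *)
Lemma entropy_optimize (R : realType) (L K I : R) : 0 <= L -> 0 < K ->
  (forall t1 t2, 0 < t1 -> 0 < t2 <= 1 ->
     I <= (L / t1 + t2^-1) * K + L * t1 / 2 + t2) ->
  I <= 2 * (3 / 2 + L) * (K + Num.sqrt (K / 2)).
Proof.
move=> L0 K0 h; set r := Num.sqrt (K / 2).
have r0 : 0 < r by rewrite sqrtr_gt0; lra.
have Kr : K = 2 * r ^+ 2 by rewrite /r sqr_sqrtr; lra.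
have lr : L / (2 * r) * K + L * (2 * r) / 2 = L * (2 * r).
  by rewrite Kr; field; rewrite gt_eqF.
have LK : 0 <= L * K by rewrite mulr_ge0// ltW.
(* [7/5 * r] is admissible as [t2] up to [r = 5/7], and then [K / t2 + t2 = (10/7 + 7/5) r = 99/35 r
   <= 3 r]. Beyond that [t2 = 1], and the extra term 1 is below [3 r]. *)
have [r57|r57] := leP r (5 / 7).
  have -> : 2 * (3 / 2 + L) * (K + r) = 3 * r + 3 * K + 2 * (L * K) + L * (2 * r).
    by field.
  have s0 : 0 < 7 / 5 * r by lra.
  have s1 : 0 < 7 / 5 * r <= 1 by lra.
  have r20 : 0 < 2 * r by lra.
  have := h _ _ r20 s1.
  rewrite [(_ + _) * K]mulrDl.
  have -> : (7 / 5 * r)^-1 * K = 10 / 7 * r.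
    by rewrite Kr; field; rewrite gt_eqF.
  by move=> /le_trans; apply; lra.
have r20 : 0 < 2 * r by lra.
have := h (2 * r) 1 r20; rewrite ltr01 lexx => /(_ isT).
rewrite [(_ + _) * K]mulrDl invr1 mul1r => /le_trans; apply.
have -> : 2 * (3 / 2 + L) * (K + r) = 3 * r + 3 * K + 2 * (L * K) + L * (2 * r).
  by field.
by lra.
Qed.

(** * Euclidean distance *)

Lemma dist2_ge0 (R : realType) (d : nat) (x y : 'rV[R]_d) : 0 <= dist2 x y.
Proof. exact: sqrtr_ge0. Qed.

Lemma dist2_xx (R : realType) (d : nat) (x : 'rV[R]_d) : dist2 x x = 0.
Proof.
by rewrite /dist2 big1 ?sqrtr0// => i _; rewrite subrr expr0n.
Qed.

Lemma dist2C (R : realType) (d : nat) (x y : 'rV[R]_d) : dist2 x y = dist2 y x.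
Proof.
by congr Num.sqrt; apply: eq_bigr => i _; rewrite -sqrrN opprB.
Qed.

Lemma sqrt_sum_sqrD (R : rcfType) (I : finType) (a b : I -> R) :
  Num.sqrt (\sum_i (a i + b i) ^+ 2)
    <= Num.sqrt (\sum_i a i ^+ 2) + Num.sqrt (\sum_i b i ^+ 2).
Proof.
set A := Num.sqrt (\sum_i a i ^+ 2); set B := Num.sqrt (\sum_i b i ^+ 2).
have sq0 (f : I -> R) : 0 <= \sum_i f i ^+ 2.
  by apply: sumr_ge0 => i _; exact: sqr_ge0.
have A0 : 0 <= A := sqrtr_ge0 _; have B0 : 0 <= B := sqrtr_ge0 _.
have AE : A ^+ 2 = \sum_i a i ^+ 2 by rewrite sqr_sqrtr.
have BE : B ^+ 2 = \sum_i b i ^+ 2 by rewrite sqr_sqrtr.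
have null (f : I -> R) : \sum_i f i ^+ 2 = 0 -> forall i, f i = 0.
  move=> /eqP; rewrite psumr_eq0; last by move=> i _; exact: sqr_ge0.
  by move=> /allP h i; have /= := h i (mem_index_enum i); rewrite sqrf_eq0 => /eqP.
have CS : \sum_i a i * b i <= A * B.
  have [A00|A00] := eqVneq A 0.
    rewrite A00 mul0r big1// => i _; rewrite (null a) ?mul0r//.
    by rewrite -AE A00 expr0n.
  have [B00|B00] := eqVneq B 0.
    rewrite B00 mulr0 big1// => i _; rewrite (null b) ?mulr0//.
    by rewrite -BE B00 expr0n.
  have AB0 : 0 < A * B by rewrite mulr_gt0// lt_neqAle eq_sym ?A00 ?B00.
  (* Expanding this nonnegative sum yields Cauchy-Schwarz times [2 A B]. Cancelling that factor
     requires [A B > 0], hence the two cases above. *)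
  have := sq0 (fun i => B * a i - A * b i).
  have -> : \sum_i (B * a i - A * b i) ^+ 2 =
      2 * (A * B) * (A * B - \sum_i a i * b i).
    transitivity (\sum_i (B ^+ 2 * a i ^+ 2 + A ^+ 2 * b i ^+ 2
        - 2 * (A * B) * (a i * b i))).
      by apply: eq_bigr => i _; ring.
    rewrite big_split big_split sumrN -!mulr_sumr/= -AE -BE; ring.
  by rewrite pmulr_rge0 ?subr_ge0// mulr_gt0.
rewrite -ler_sqr ?nnegrE ?sqrtr_ge0 ?addr_ge0//.
rewrite sqr_sqrtr// sqrrD AE BE.
under eq_bigr do rewrite sqrrD.
by rewrite !big_split/= lerD2r lerD2l -mulr2n lerMn2r.
Qed.

Lemma dist2_triangle (R : realType) (d : nat) (z x y : 'rV[R]_d) :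
  dist2 x y <= dist2 x z + dist2 z y.
Proof.
apply: le_trans (sqrt_sum_sqrD _ _); rewrite le_eqVlt; apply/orP; left; apply/eqP.
by congr Num.sqrt; apply: eq_bigr => i _; rewrite addrA subrK.
Qed.

Lemma measurable_coord (R : realType) (d : nat) (i : 'I_d) :
  measurable_fun [set: borelRn R d] (fun x => (x : 'rV[R]_d) ord0 i).
Proof.
apply: (measurability (@RGenOInfty.G R)); first exact: RGenOInfty.measurableE.
move=> _ [_ [x ->] <-]; apply: sub_sigma_algebra; rewrite setTI.
by apply: open_comp => [y _|]; [exact: coord_continuous|exact: interval_open].
Qed.

(** The pairs carry the product sigma-algebra, not the one generated by the open sets of the
    product, so measurability goes through the coordinates instead of joint continuity. *)
Lemma measurable_dist2 (R : realType) (d : nat) :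
  measurable_fun [set: (borelRn R d * borelRn R d)%type]
    (fun z => dist2 z.1 z.2).
Proof.
apply: (measurableT_comp (continuous_measurable_fun (@sqrt_continuous R))).
apply: measurable_sum => i; apply: measurable_funX; apply: measurable_funB.
  exact: measurableT_comp (measurable_coord i) measurable_fst.
exact: measurableT_comp (measurable_coord i) measurable_snd.
Qed.

Lemma measurable_dist2_powR (R : realType) (d : nat) (p : R) (t : 'rV[R]_d) :
  measurable_fun [set: borelRn R d] (fun x => dist2 x t `^ p).
Proof.
apply: (measurableT_comp (measurable_powR p)).
exact: (measurableT_comp (@measurable_dist2 R d)
  (@pair2_measurable _ _ (borelRn R d) (borelRn R d) t)).
Qed.

Local Open Scope ereal_scope.

(** * Densities and couplings *)

Section measure_with_finite_mass.
Context d (T : measurableType d) (R : realType).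
Variable m : {measure set T -> \bar R}.

(** The finiteness proof is an argument so that the copy can carry the structure of a finite
    measure, which [m] itself lacks. *)
Definition finite_copy of m setT < +oo := m : set T -> \bar R.

Variable m_lty : m setT < +oo.

HB.instance Definition _ := Measure.on (finite_copy m_lty).

Let finite_copy_fin : fin_num_fun (finite_copy m_lty).
Proof. exact: lty_fin_num_fun. Qed.

HB.instance Definition _ :=
  Measure_isFinite.Build _ _ _ (finite_copy m_lty) finite_copy_fin.

End measure_with_finite_mass.

Section measure_with_unit_mass.
Context d (T : measurableType d) (R : realType).
Variable m : {measure set T -> \bar R}.

Definition probability_copy of m setT = 1 := m : set T -> \bar R.

Variable m1 : m setT = 1.

HB.instance Definition _ := Measure.on (probability_copy m1).

HB.instance Definition _ :=
  Measure_isProbability.Build _ _ _ (probability_copy m1) m1.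

End measure_with_unit_mass.

Section density.
Context d (T : measurableType d) (R : realType).
Variables (mu : probability T R) (h : T -> R).
Hypotheses (h0 : forall x, (0 <= h x)%R) (mh : measurable_fun [set: T] h).

(** Change of variables is available for the Radon-Nikodym derivative of [D]. It transfers to [h],
    which agrees with that derivative almost everywhere because both have the same integral over
    every measurable set. *)
Lemma exists_density :
  \int[mu]_x (h x)%:E < +oo ->
  exists D : {finite_measure set T -> \bar R},
    forall f : T -> \bar R, (forall x, 0 <= f x) -> measurable_fun [set: T] f ->
      \int[D]_x f x = \int[mu]_x (f x * (h x)%:E).
Proof.
move=> hfin.
have mhE : measurable_fun [set: T] (EFin \o h) by exact/measurable_EFinP.
have hE0 x : 0 <= (h x)%:E by rewrite lee_fin.
have inth : mu.-integrable setT (EFin \o h).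
  apply/integrableP; split => //.
  rewrite (eq_integral (EFin \o h))// => x _ /=.
  by rewrite ger0_norm.
pose D0 := fun A : set T => \int[mu]_(x in A) (h x)%:E.
have D00 : D0 set0 = 0 by rewrite /D0 integral_set0.
have D0ge0 A : 0 <= D0 A by apply: integral_ge0 => x _; exact: hE0.
have D0sa : semi_sigma_additive D0 by apply: semi_sigma_additive_nng_induced.
pose D1 := HB.pack_for {measure set T -> \bar R} D0
  (isMeasure.Build _ _ _ D0 D00 D0ge0 D0sa).
pose D : {finite_measure set T -> \bar R} := finite_copy (hfin : D1 setT < +oo).
exists D => f f0 mf.
have Dmu : D `<< mu.
  apply/null_content_dominatesP => A mA muA.
  rewrite /D/= /finite_copy/=; apply: null_set_integral => //.
  exact: measurable_funTS.
rewrite -(Radon_Nikodym_SigmaFinite.change_of_variables Dmu)//.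
apply: ge0_ae_eq_integral => //.
- apply: emeasurable_funM => //.
  exact: measurable_int (Radon_Nikodym_SigmaFinite.f_integrable Dmu).
- exact: emeasurable_funM.
- by move=> x _; rewrite mule_ge0// Radon_Nikodym_SigmaFinite.f_ge0.
- by move=> x _; rewrite mule_ge0.
- apply: ae_eqe_mul2l; apply: integral_ae_eq => //.
  + exact: Radon_Nikodym_SigmaFinite.f_integrable.
  + move=> E _ mE; rewrite -Radon_Nikodym_SigmaFinite.f_integral//.
Qed.

End density.

(** A version of the derivative that is finite everywhere permits real arithmetic on [g]. The last
    clause links it back to the derivative used in [KL] and [D2]. *)
Lemma exists_real_density d (T : measurableType d) (R : realType)
    (nu pi : probability T R) : pi `<< nu ->
  exists g : T -> R, [/\ measurable_fun [set: T] g, forall x, (0 <= g x)%R,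
    (forall f : T -> \bar R, (forall x, 0 <= f x) -> measurable_fun [set: T] f ->
      \int[pi]_x f x = \int[nu]_x (f x * (g x)%:E)) &
    ae_eq nu setT (EFin \o g)
      (Radon_Nikodym (charge_of_finite_measure pi) nu)].
Proof.
move=> pinu; pose f := Radon_Nikodym_SigmaFinite.f pi nu.
have f0 : forall x, 0 <= f x := Radon_Nikodym_SigmaFinite.f_ge0 pinu.
have fE x : (fine (f x))%:E = f x.
  by rewrite fineK// Radon_Nikodym_SigmaFinite.f_fin_num.
have mf : measurable_fun [set: T] f.
  exact: measurable_int (Radon_Nikodym_SigmaFinite.f_integrable pinu).
exists (fine \o f); split.
- exact/measurableT_comp.
- by move=> x; exact: fine_ge0.
- move=> k k0 mk; rewrite -(Radon_Nikodym_SigmaFinite.change_of_variables pinu)//.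
  by apply: eq_integral => x _ /=; rewrite fE.
- rewrite (_ : EFin \o _ = f); last by apply/funext => x /=.
  exact: ae_eq_Radon_Nikodym_SigmaFinite.
Qed.

Section equal_mass_coupling.
Context d (T : measurableType d) (R : realType).
Variables (nu : probability T R) (a b : T -> R) (delta : R).
Hypotheses (a0 : forall x, (0 <= a x)%R) (b0 : forall x, (0 <= b x)%R).
Hypotheses (ma : measurable_fun [set: T] a) (mb : measurable_fun [set: T] b).
Hypotheses (ia : \int[nu]_x (a x)%:E = delta%:E).
Hypotheses (ib : \int[nu]_x (b x)%:E = delta%:E).

(** For [delta = 0] the convention [0^-1 = 0] makes the left-hand side 0; then [u] vanishes almost
    everywhere, and so does the right-hand side. *)
Let renormalize (u : T -> R) (k : T -> \bar R) :
  (forall x, (0 <= u x)%R) -> measurable_fun [set: T] u ->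
  \int[nu]_x (u x)%:E = delta%:E ->
  (forall x, 0 <= k x) -> measurable_fun [set: T] k ->
  \int[nu]_x (k x * (u x)%:E) * (delta^-1 * delta)%:E
    = \int[nu]_x (k x * (u x)%:E).
Proof.
move=> u0 mu iu k0 mk; have [d0|d0] := eqVneq delta 0%R; last first.
  by rewrite mulVf// mule1.
rewrite d0 mulr0 mule0; apply/esym.
have muE : measurable_fun [set: T] (EFin \o u) by exact/measurable_EFinP.
have ae0 : ae_eq nu setT (EFin \o u) (cst 0).
  apply/ae_eq_integral_abs => //.
  rewrite (eq_integral (EFin \o u)) ?iu ?d0// => x _ /=.
  by rewrite ger0_norm.
rewrite (@ge0_ae_eq_integral _ _ _ _ _ _ (cst 0)) ?integral0//.
- exact: emeasurable_funM.
- by move=> x _; rewrite mule_ge0// lee_fin.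
- apply: filterS ae0 => x /= /(_ Logic.I) [ux] _.
  by rewrite ux mule0.
Qed.

(** The coupling has density [a(x) b(y) / delta] with respect to [nu \x nu]; by Tonelli, integrating
    out one variable produces the mass [delta] that cancels the normalization. Marginals are tested
    on functions, the form in which a cost is integrated. *)
Lemma exists_equal_mass_coupling :
  exists D : {finite_measure set (T * T)%type -> \bar R},
    (forall k : T -> \bar R, (forall x, 0 <= k x) -> measurable_fun [set: T] k ->
      \int[D]_z k z.1 = \int[nu]_x (k x * (a x)%:E)) /\
    (forall k : T -> \bar R, (forall x, 0 <= k x) -> measurable_fun [set: T] k ->
      \int[D]_z k z.2 = \int[nu]_x (k x * (b x)%:E)).
Proof.
have d0 : (0 <= delta)%R.
  by rewrite -lee_fin -ia integral_ge0// => x _; rewrite lee_fin.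
have di0 : (0 <= delta^-1)%R by rewrite invr_ge0.
pose h (z : T * T) := (delta^-1 * (a z.1 * b z.2))%R.
have h0 z : (0 <= h z)%R by rewrite mulr_ge0// mulr_ge0.
have mh : measurable_fun [set: (T * T)%type] h.
  apply: measurable_funM => //; apply: measurable_funM.
    exact: measurableT_comp ma measurable_fst.
  exact: measurableT_comp mb measurable_snd.
have maE : measurable_fun [set: T] (EFin \o a) by exact/measurable_EFinP.
have mbE : measurable_fun [set: T] (EFin \o b) by exact/measurable_EFinP.
have mhE : measurable_fun [set: (T * T)%type] (EFin \o h) by exact/measurable_EFinP.
have E1 (k : T -> \bar R) : (forall x, 0 <= k x) -> measurable_fun [set: T] k ->
    \int[(nu \x nu)%E]_z (k z.1 * (h z)%:E) = \int[nu]_x (k x * (a x)%:E).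
  move=> k0 mk; rewrite fubini_tonelli1//=; last 2 first.
  - apply: emeasurable_funM => //.
    exact: measurableT_comp mk measurable_fst.
  - by move=> z; rewrite mule_ge0// lee_fin.
  rewrite -renormalize// -ge0_integralZr//; last 3 first.
  - exact: emeasurable_funM.
  - by move=> x _; rewrite mule_ge0// lee_fin.
  - by rewrite lee_fin mulr_ge0.
  apply: eq_integral => x _; rewrite /fubini_F/=.
  rewrite (eq_integral (fun y => k x * (delta^-1 * a x)%:E * (b y)%:E)).
    rewrite ge0_integralZl//=; last 2 first.
    - by move=> y _; rewrite lee_fin.
    - by rewrite mule_ge0// lee_fin mulr_ge0.
    by rewrite ib -!muleA -!EFinM; congr (_ * _%:E); ring.
  by move=> y _; rewrite -muleA -EFinM /h /= mulrA.
have E2 (k : T -> \bar R) : (forall x, 0 <= k x) -> measurable_fun [set: T] k ->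
    \int[(nu \x nu)%E]_z (k z.2 * (h z)%:E) = \int[nu]_x (k x * (b x)%:E).
  move=> k0 mk; rewrite fubini_tonelli2//=; last 2 first.
  - apply: emeasurable_funM => //.
    exact: measurableT_comp mk measurable_snd.
  - by move=> z; rewrite mule_ge0// lee_fin.
  rewrite -renormalize// -ge0_integralZr//; last 3 first.
  - exact: emeasurable_funM.
  - by move=> x _; rewrite mule_ge0// lee_fin.
  - by rewrite lee_fin mulr_ge0.
  apply: eq_integral => y _; rewrite /fubini_G/=.
  rewrite (eq_integral (fun x => k y * (delta^-1 * b y)%:E * (a x)%:E)).
    rewrite ge0_integralZl//=; last 2 first.
    - by move=> x _; rewrite lee_fin.
    - by rewrite mule_ge0// lee_fin mulr_ge0.
    by rewrite ia -!muleA -!EFinM; congr (_ * _%:E); ring.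
  by move=> x _; rewrite -muleA -EFinM /h /=; congr (_ * _%:E); ring.
have hfin : \int[(nu \x nu)%E]_z (h z)%:E < +oo.
  have := E1 (cst 1); under eq_integral do rewrite mul1e.
  move=> ->//; under eq_integral do rewrite mul1e.
  by rewrite ia ltry.
have [D HD] := exists_density h0 mh hfin.
exists D; split => k k0 mk.
- by rewrite HD ?E1//; exact: measurableT_comp mk measurable_fst.
- by rewrite HD ?E2//; exact: measurableT_comp mk measurable_snd.
Qed.

End equal_mass_coupling.

Section overlap_coupling.
Context d (T : measurableType d) (R : realType).
Variables (nu pi : probability T R) (g : T -> R).
Hypotheses (g0 : forall x, (0 <= g x)%R) (mg : measurable_fun [set: T] g).
Hypothesis pi_g : forall f : T -> \bar R, (forall x, 0 <= f x) ->
  measurable_fun [set: T] f -> \int[pi]_x f x = \int[nu]_x (f x * (g x)%:E).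

Lemma integral_density1 : \int[nu]_x (g x)%:E = 1.
Proof.
have pi1 : \int[pi]_x (cst 1 x) = 1.
  by rewrite integral_cst// mul1e; exact: probability_setT.
rewrite -pi1 pi_g//; by apply: eq_integral => x _; rewrite mul1e.
Qed.

(* [min(g, 1)] is the mass shared by [nu] and [pi], which the coupling leaves
   in place; [a = (1 - g)^+] and [b = (g - 1)^+] have the same total mass and
   are coupled by their normalized product. *)
Lemma exists_overlap_coupling : exists gamma : probability (T * T)%type R,
  [/\ forall A, measurable A -> gamma (fst @^-1` A) = nu A,
      forall A, measurable A -> gamma (snd @^-1` A) = pi A &
      forall (c : T * T -> R) (w : T -> R),
        measurable_fun [set: (T * T)%type] c -> measurable_fun [set: T] w ->
        (forall z, (0 <= c z)%R) -> (forall x, (0 <= w x)%R) ->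
        (forall x, c (x, x) = 0%R) -> (forall x y, (c (x, y) <= w x + w y)%R) ->
        \int[gamma]_z (c z)%:E <= \int[nu]_x (w x * `|g x - 1|)%:E].
Proof.
pose m x := Num.min (g x) 1%R.
pose a x := Num.max (1 - g x)%R 0%R; pose b x := Num.max (g x - 1)%R 0%R.
have m0 x : (0 <= m x)%R by rewrite le_min g0 ler01.
have a0 x : (0 <= a x)%R by rewrite le_max lexx orbT.
have b0 x : (0 <= b x)%R by rewrite le_max lexx orbT.
have mm : measurable_fun [set: T] m by exact: measurable_minr.
have ma : measurable_fun [set: T] a.
  by apply: measurable_maxr => //; exact: measurable_funB.
have mb : measurable_fun [set: T] b.
  by apply: measurable_maxr => //; exact: measurable_funB.
have mE (u : T -> R) : measurable_fun [set: T] u ->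
  measurable_fun [set: T] (EFin \o u) by move=> ?; exact/measurable_EFinP.
have ma1 x : (m x + a x = 1)%R.
  rewrite /m /a; case: (leP (g x) 1%R) => h; first by rewrite max_l; lra.
  by rewrite max_r; lra.
have mbg x : (m x + b x = g x)%R.
  rewrite /m /b; case: (leP (g x) 1%R) => h; first by rewrite max_r; lra.
  by rewrite max_l; lra.
have abg x : (a x + b x = `|g x - 1|)%R.
  have := ma1 x; have := mbg x.
  rewrite /m; case: (leP (g x) 1%R) => h.
    by rewrite ler0_norm; lra.
  by rewrite ger0_norm; lra.
have split_mass (u v s : T -> R) (k : T -> \bar R) :
    (forall x, (0 <= u x)%R) -> (forall x, (0 <= v x)%R) ->
    measurable_fun [set: T] u -> measurable_fun [set: T] v ->
    (forall x, 0 <= k x) -> measurable_fun [set: T] k ->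
    (forall x, u x + v x = s x)%R ->
    \int[nu]_x (k x * (u x)%:E) + \int[nu]_x (k x * (v x)%:E)
      = \int[nu]_x (k x * (s x)%:E).
  move=> u0 v0 mu mv k0 mk uvs; rewrite -ge0_integralD//; last 4 first.
  - by move=> x _; rewrite mule_ge0// lee_fin.
  - by apply: emeasurable_funM => //; exact: mE.
  - by move=> x _; rewrite mule_ge0// lee_fin.
  - by apply: emeasurable_funM => //; exact: mE.
  apply: eq_integral => x _; rewrite -uvs EFinD ge0_muleDr// lee_fin//.
have split1 (u v s : T -> R) :
    (forall x, (0 <= u x)%R) -> (forall x, (0 <= v x)%R) ->
    measurable_fun [set: T] u -> measurable_fun [set: T] v ->
    (forall x, u x + v x = s x)%R ->
    \int[nu]_x (u x)%:E + \int[nu]_x (v x)%:E = \int[nu]_x (s x)%:E.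
  move=> u0 v0 mu mv uvs; have := @split_mass u v s (cst 1) u0 v0 mu mv.
  have one (f : T -> \bar R) : \int[nu]_x (cst 1 x * f x) = \int[nu]_x f x.
    by apply: eq_integral => x _; rewrite mul1e.
  by rewrite !one => ->.
have im1 := split1 m a (cst 1%R) m0 a0 mm ma ma1.
have im2 := split1 m b g m0 b0 mm mb mbg.
have {}im1 : \int[nu]_x (m x)%:E + \int[nu]_x (a x)%:E = 1.
  have nu1 : \int[nu]_x (cst 1 x) = 1.
    by rewrite integral_cst// mul1e; exact: probability_setT.
  by rewrite im1 -[RHS]nu1.
rewrite integral_density1 in im2.
have imge0 : 0 <= \int[nu]_x (m x)%:E.
  by apply: integral_ge0 => x _; rewrite lee_fin.
have iage0 : 0 <= \int[nu]_x (a x)%:E.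
  by apply: integral_ge0 => x _; rewrite lee_fin.
have imfin : \int[nu]_x (m x)%:E \is a fin_num.
  rewrite ge0_fin_numE//; apply: (@le_lt_trans _ _ 1); last exact: ltry.
  by rewrite -im1 leeDl.
(* Both remainders complete the finite mass of [m] to 1. *)
have iab : \int[nu]_x (b x)%:E = \int[nu]_x (a x)%:E.
  have cancel y : \int[nu]_x (m x)%:E + y = 1 -> y = 1 - \int[nu]_x (m x)%:E.
    by move=> <-; rewrite [X in _ = X - _]addeC addeK.
  by rewrite (cancel _ im1) (cancel _ im2).
have iafin : \int[nu]_x (a x)%:E \is a fin_num.
  rewrite ge0_fin_numE//; apply: (@le_lt_trans _ _ 1); last exact: ltry.
  by rewrite -im1 leeDr.
have imlty : \int[nu]_x (m x)%:E < +oo by rewrite -ge0_fin_numE.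
have [D1 HD1] := exists_density m0 mm imlty.
(* Within this proof [D2] is the coupling of the two remainders, not the divergence. *)
have [D2 [HD21 HD22]] := @exists_equal_mass_coupling _ _ _ nu a b
  (fine (\int[nu]_x (a x)%:E)) a0 b0 ma mb
  (esym (fineK iafin)) (etrans iab (esym (fineK iafin))).
have mdiag : measurable_fun [set: T] (fun x : T => (x, x)).
  exact: measurable_fun_pair.
pose diag (x : T) := (x, x).
pose image_diag : {measure set (T * T)%type -> \bar R} := pushforward D1 diag.
pose gamma0 : {measure set (T * T)%type -> \bar R} :=
  measure_add (image_diag mdiag) D2.
have gammaE (f : T * T -> \bar R) : (forall z, 0 <= f z) ->
    measurable_fun [set: (T * T)%type] f ->
    \int[gamma0]_z f z = \int[nu]_x (f (x, x) * (m x)%:E) + \int[D2]_z f z.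
  move=> f0 mf; rewrite ge0_integral_measure_add//.
  rewrite ge0_integral_pushforward// preimage_setT HD1//.
    by move=> x; exact: f0.
  exact: measurableT_comp mf mdiag.
have mindic A : measurable A -> measurable_fun [set: T] (fun x => (\1_A x : R)%:E).
  by move=> mA; apply: mE; exact: measurable_indic.
have indic0 A x : 0 <= (\1_A x : R)%:E by rewrite lee_fin.
have indicI (p : probability T R) A : measurable A -> p A = \int[p]_x (\1_A x)%:E.
  by move=> mA; rewrite integral_indic// setIT.
have marg1 A : measurable A -> gamma0 (fst @^-1` A) = nu A.
  move=> mA; have mfA : measurable (fst @^-1` A : set (T * T)%type).
    by rewrite -[X in measurable X]setTI; exact: measurable_fst.
  transitivity (\int[gamma0]_z (\1_(fst @^-1` A) z : R)%:E).
    by rewrite integral_indic// setIT.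
  rewrite (eq_integral (fun z => (\1_A z.1)%:E))//.
  rewrite gammaE//; last exact: measurableT_comp (mindic _ mA) measurable_fst.
  rewrite (HD21 (fun x => (\1_A x)%:E))//=; last exact: mindic.
  rewrite (split_mass m a (cst 1%R))//; last exact: mindic.
  by rewrite indicI//; apply: eq_integral => x _; rewrite mule1.
have marg2 A : measurable A -> gamma0 (snd @^-1` A) = pi A.
  move=> mA; have mfA : measurable (snd @^-1` A : set (T * T)%type).
    by rewrite -[X in measurable X]setTI; exact: measurable_snd.
  transitivity (\int[gamma0]_z (\1_(snd @^-1` A) z : R)%:E).
    by rewrite integral_indic// setIT.
  rewrite (eq_integral (fun z => (\1_A z.2)%:E))//.
  rewrite gammaE//; last exact: measurableT_comp (mindic _ mA) measurable_snd.
  rewrite (HD22 (fun x => (\1_A x)%:E))//=; last exact: mindic.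
  rewrite (split_mass m b g)//; last exact: mindic.
  by rewrite indicI// pi_g//; exact: mindic.
have gamma1 : gamma0 setT = 1.
  by rewrite -(preimage_setT fst) marg1//; exact: probability_setT.
exists (probability_copy gamma1); split => // c w mc mw c0 w0 c_diag cw.
rewrite (_ : \int[_]_z _ = \int[gamma0]_z (c z)%:E)//.
rewrite gammaE//; last exact/measurable_EFinP.
(* The shared mass sits on the diagonal, where the cost is 0. On [D2] the cost splits into a
   function of each coordinate, and the marginals contribute [w a + w b = w |g - 1|]. *)
rewrite (eq_integral (cst 0)) ?integral0 ?add0e; last first.
  by move=> x _; rewrite c_diag mul0e.
apply: (@le_trans _ _ (\int[D2]_z ((w z.1)%:E + (w z.2)%:E))).
  apply: ge0_le_integral => //.
  - by move=> z _; rewrite lee_fin.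
  - exact/measurable_EFinP.
  - apply: emeasurable_funD; apply/measurable_EFinP.
      exact: measurableT_comp mw measurable_fst.
    exact: measurableT_comp mw measurable_snd.
  - by case=> x y _; rewrite -EFinD lee_fin.
rewrite ge0_integralD//; last 4 first.
- by move=> z _; rewrite lee_fin.
- by apply/measurable_EFinP; exact: measurableT_comp mw measurable_fst.
- by move=> z _; rewrite lee_fin.
- by apply/measurable_EFinP; exact: measurableT_comp mw measurable_snd.
rewrite (HD21 (fun x => (w x)%:E))//; last exact: mE.
rewrite (HD22 (fun x => (w x)%:E))//; last exact: mE.
rewrite (split_mass a b (fun x => `|g x - 1|%R))//; last exact: mE.
Qed.

End overlap_coupling.

(** * Weighted Pinsker inequality *)

Lemma measurable_rel_entr (R : realType) : measurable_fun [set: R] (@rel_entr R).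
Proof.
apply: measurable_funD => //; apply: measurable_funB => //.
by apply: measurable_funM => //; exact: measurable_ln.
Qed.

Lemma measurable_lne (R : realType) : measurable_fun [set: \bar R] (@lne R).
Proof.
have -> : @lne R = fun x => if x <= 0 then -oo else er_map (@ln R) x.
  by apply/funext => -[r| |]/=; rewrite ?lee_fin ?leNye ?leye_eq.
apply: measurable_fun_ifT => //.
  by apply: measurable_fun_lee => //; exact: measurable_cst.
exact: (@measurable_er_map _ (measurableTypeR R) _ _ (@measurable_ln R)).
Qed.

Section weight_product.
Context d (T : measurableType d) (R : realType) (mu : {measure set T -> \bar R}).

Lemma ge0_integral_eq0_mul (u v : T -> R) :
  measurable_fun [set: T] u -> measurable_fun [set: T] v ->
  (forall x, (0 <= u x)%R) -> (forall x, (0 <= v x)%R) ->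
  \int[mu]_x (u x)%:E = 0 -> \int[mu]_x (u x * v x)%:E = 0.
Proof.
move=> mmu mv u0 v0 iu.
have ae0 : ae_eq mu setT (EFin \o u) (cst 0).
  apply/ae_eq_integral_abs => //; first exact/measurable_EFinP.
  rewrite -iu; apply: eq_integral => x _ /=.
  by rewrite ger0_norm.
rewrite (@ge0_ae_eq_integral _ _ _ _ _ _ (cst 0)) ?integral0//.
- by apply/measurable_EFinP; exact: measurable_funM.
- by move=> x _; rewrite lee_fin mulr_ge0.
- apply: filterS ae0 => x /= /(_ Logic.I) [ux] _.
  by rewrite ux mul0r.
Qed.

End weight_product.

Section entropy.
Context d (T : measurableType d) (R : realType) (nu : probability T R).
Variable g : T -> R.
Hypotheses (g0 : forall x, (0 <= g x)%R) (mg : measurable_fun [set: T] g).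
Hypothesis g1 : \int[nu]_x (g x)%:E = 1.

Let mabs : measurable_fun [set: T] (fun x => `|g x - 1|%R).
Proof. by apply: measurableT_comp => //; exact: measurable_funB. Qed.

Let mrel : measurable_fun [set: T] (fun x => rel_entr (g x)).
Proof. by apply: measurableT_comp mg; exact: measurable_rel_entr. Qed.

Let nu1 : \int[nu]_x 1%:E = 1 :> \bar R.
Proof.
have := @integral_cst _ _ _ nu setT measurableT 1.
by rewrite mul1e => ->; exact: probability_setT.
Qed.

(** Three terms fit the integrand of the weighted inequality; shorter combinations are padded with
    [0 * 0]. *)
Let integral3 (c1 c2 c3 : R) (f1 f2 f3 : T -> R) :
  (0 <= c1)%R -> (0 <= c2)%R -> (0 <= c3)%R ->
  (forall x, (0 <= f1 x)%R) -> (forall x, (0 <= f2 x)%R) ->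
  (forall x, (0 <= f3 x)%R) ->
  measurable_fun [set: T] f1 -> measurable_fun [set: T] f2 ->
  measurable_fun [set: T] f3 ->
  \int[nu]_x (c1 * f1 x + c2 * f2 x + c3 * f3 x)%:E =
  c1%:E * \int[nu]_x (f1 x)%:E + c2%:E * \int[nu]_x (f2 x)%:E +
  c3%:E * \int[nu]_x (f3 x)%:E.
Proof.
move=> c10 c20 c30 f10 f20 f30 mf1 mf2 mf3.
under eq_integral do rewrite 2!EFinD.
have mc (c : R) (f : T -> R) : measurable_fun [set: T] f ->
    measurable_fun [set: T] (fun x => (c * f x)%:E).
  by move=> mf; apply/measurable_EFinP; exact: measurable_funM.
have cf0 (c : R) (f : T -> R) x : (0 <= c)%R ->
    (forall x : T, (0 <= f x)%R) -> 0 <= (c * f x)%:E.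
  by move=> c0 f0; rewrite lee_fin mulr_ge0.
have cZ (c : R) (f : T -> R) : (0 <= c)%R -> (forall x : T, (0 <= f x)%R) ->
    measurable_fun [set: T] f ->
    \int[nu]_x (c * f x)%:E = c%:E * \int[nu]_x (f x)%:E.
  move=> c0 f0 mf; under eq_integral do rewrite EFinM.
  rewrite ge0_integralZl ?lee_fin//; first exact/measurable_EFinP.
  by move=> x _; rewrite lee_fin.
rewrite ge0_integralD//; last 4 first.
- by move=> x _; rewrite adde_ge0// cf0.
- by apply: emeasurable_funD; exact: mc.
- by move=> x _; rewrite cf0.
- exact: mc.
rewrite ge0_integralD//; last 4 first.
- by move=> x _; rewrite cf0.
- exact: mc.
- by move=> x _; rewrite cf0.
- exact: mc.
by rewrite !cZ.
Qed.

(** The zero-entropy case, which [weighted_pinsker] excludes by [0 < K]. The linearized bound with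
    parameter [2 e] integrates to exactly [e], for every [e > 0]. *)
Lemma integral_abs_sub1_eq0 : \int[nu]_x (rel_entr (g x))%:E = 0 ->
  \int[nu]_x (`|g x - 1|)%:E = 0.
Proof.
move=> h0; apply/eqP; rewrite eq_le integral_ge0 ?andbT; last first.
  by move=> x _; rewrite lee_fin.
apply/lee_addgt0Pr => e e0; rewrite add0e.
have e20 : (0 < 2 * e)%R by rewrite mulr_gt0.
apply: (@le_trans _ _ (\int[nu]_x
    ((2 * e)^-1 * rel_entr (g x) + (e / 3) * g x + (2 / 3 * e) * 1)%:E)).
  apply: ge0_le_integral => //.
  - exact/measurable_EFinP.
  - apply/measurable_EFinP; apply: measurable_funD => //.
    by apply: measurable_funD => //; exact: measurable_funM.
  - move=> x _; rewrite lee_fin.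
    have := abs_sub1_le_rel_entr (g0 x) e20; lra.
rewrite (integral3 _ _ _ _ (f3 := cst 1%R))//; last 4 first.
- by rewrite invr_ge0 ltW.
- by rewrite divr_ge0// ltW.
- by rewrite mulr_ge0// ltW.
- by move=> x; exact: rel_entr_ge0.
by rewrite h0 mule0 add0e g1 nu1 !mule1 -EFinD lee_fin; lra.
Qed.

Lemma log_mgf_ge0 (phi : T -> R) (L : R) :
  (forall x, (0 <= phi x)%R) -> measurable_fun [set: T] phi ->
  \int[nu]_x (expR (phi x))%:E = (expR L)%:E -> (0 <= L)%R.
Proof.
move=> phi0 mphi iL.
have expR_ge1 (x : R) : (1 <= expR x)%R = (0 <= x)%R.
  by rewrite -[X in (X <= _)%R]expR0 ler_expR.
rewrite -expR_ge1 -lee_fin -iL -nu1; apply: ge0_le_integral => //.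
- apply/measurable_EFinP.
  by apply: measurableT_comp mphi; exact: measurable_expR.
- by move=> x _; rewrite lee_fin expR_ge1.
Qed.

Lemma weighted_pinsker (phi : T -> R) (L K : R) :
  (forall x, (0 <= phi x)%R) -> measurable_fun [set: T] phi ->
  \int[nu]_x (expR (phi x))%:E = (expR L)%:E -> (0 < K)%R ->
  \int[nu]_x (rel_entr (g x))%:E <= K%:E ->
  \int[nu]_x (phi x * `|g x - 1|)%:E
    <= (2 * (3 / 2 + L) * (K + Num.sqrt (K / 2)))%:E.
Proof.
move=> phi0 mphi iL K0 iK.
have mexp : measurable_fun [set: T] (fun x => expR (phi x)).
  by apply: measurableT_comp mphi; exact: measurable_expR.
have L0 : (0 <= L)%R := log_mgf_ge0 phi0 mphi iL.
(* Integrates the pointwise bound, using [\int (g + 2) = 3] and [\int expR (phi - L) = 1]. *)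
have bound t1 t2 : (0 < t1)%R -> (0 < t2 <= 1)%R ->
    \int[nu]_x (phi x * `|g x - 1|)%:E
      <= ((L / t1 + t2^-1) * K + L * t1 / 2 + t2)%:E.
  move=> t10 /andP[t20 t21].
  have c1 : (0 <= L / t1 + t2^-1)%R.
    by rewrite addr_ge0 ?divr_ge0 ?invr_ge0// ltW.
  have c2 : (0 <= L * t1 / 6)%R by rewrite divr_ge0// mulr_ge0// ltW.
  have c3 : (0 <= t2 * expR (- L))%R by rewrite mulr_ge0 ?expR_ge0// ltW.
  have mg2 : measurable_fun [set: T] (fun x => g x + 2)%R.
    exact: measurable_funD.
  have g20 x : (0 <= g x + 2)%R by rewrite addr_ge0.
  apply: (@le_trans _ _ (\int[nu]_x ((L / t1 + t2^-1) * rel_entr (g x)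
      + (L * t1 / 6) * (g x + 2) + (t2 * expR (- L)) * expR (phi x))%:E)).
    apply: ge0_le_integral => //.
    - by move=> x _; rewrite lee_fin mulr_ge0.
    - by apply/measurable_EFinP; exact: measurable_funM.
    - apply/measurable_EFinP; apply: measurable_funD; last exact: measurable_funM.
      by apply: measurable_funD; exact: measurable_funM.
    - move=> x _; rewrite lee_fin -[(t2 * expR (- L) * _)%R]mulrA -expRD.
      rewrite [(- L + _)%R]addrC.
      by apply: weighted_pinsker_pointwise => //; rewrite t20.
  rewrite integral3//; last by move=> x; exact: rel_entr_ge0.
  have -> : \int[nu]_x (g x + 2)%:E = 3%:E.
    under eq_integral do rewrite EFinD.
    rewrite ge0_integralD//; last 2 first.
    - by move=> x _; rewrite lee_fin.
    - exact/measurable_EFinP.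
    rewrite g1 (_ : \int[nu]_x 2%:E = 2%:E * \int[nu]_x 1%:E); last first.
      rewrite -ge0_integralZl ?lee_fin//.
      by apply: eq_integral => x _; rewrite mule1.
    by rewrite nu1 mule1 -EFinD; congr (_%:E); lra.
  rewrite iL -[(t2 * expR (- L))%:E * _]EFinM.
  rewrite -[(t2 * expR (- L) * _)%R]mulrA -expRD addNr expR0 mulr1.
  rewrite !EFinD; apply: leeD => //; apply: leeD.
    by rewrite [leRHS]EFinM lee_wpmul2l ?lee_fin.
  by rewrite -EFinM lee_fin; lra.
have I0 : 0 <= \int[nu]_x (phi x * `|g x - 1|)%:E.
  by apply: integral_ge0 => x _; rewrite lee_fin mulr_ge0.
(* The bound at [t1 = t2 = 1] shows finiteness, so that the optimization can be done over the
   reals. *)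
have Ifin : \int[nu]_x (phi x * `|g x - 1|)%:E \is a fin_num.
  have t2 : (0 < (1 : R) <= 1)%R by rewrite ltr01 lexx.
  rewrite ge0_fin_numE//; apply: (le_lt_trans (bound 1%R 1%R ltr01 t2)).
  exact: ltry.
rewrite -(fineK Ifin) lee_fin; apply: entropy_optimize => // t1 t2 t10 t20.
by rewrite -lee_fin (fineK Ifin); exact: bound.
Qed.

(** Jensen's inequality through the tangent line [1 + y <= expR y] at [y = phi - L]. The constants
    are placed so that both integrands are nonnegative. *)
Lemma integral_le_lne_integral_expR (phi : T -> R) (L : R) :
  (forall x, (0 <= phi x)%R) -> measurable_fun [set: T] phi ->
  \int[nu]_x (expR (phi x))%:E = (expR L)%:E -> \int[nu]_x (phi x)%:E <= L%:E.
Proof.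
move=> phi0 mphi iL.
have mexp : measurable_fun [set: T] (fun x => expR (phi x)).
  by apply: measurableT_comp mphi; exact: measurable_expR.
have L0 : (0 <= L)%R := log_mgf_ge0 phi0 mphi iL.
have : \int[nu]_x (1 * phi x + 1 * 1 + 0 * 0)%:E
    <= \int[nu]_x (expR (- L) * expR (phi x) + L * 1 + 0 * 0)%:E.
  apply: ge0_le_integral => //.
  - by move=> x _; rewrite lee_fin mul1r mulr1 mul0r addr0 addr_ge0.
  - apply/measurable_EFinP; apply: measurable_funD => //.
    by apply: measurable_funD => //; exact: measurable_funM.
  - apply/measurable_EFinP; apply: measurable_funD => //.
    by apply: measurable_funD => //; exact: measurable_funM.
  - move=> x _; rewrite lee_fin -expRD; have := expR_ge1Dx (- L + phi x); lra.
rewrite (integral3 _ _ _ _ (f2 := cst 1%R) (f3 := cst 0%R))//.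
rewrite (integral3 _ _ _ _ (f2 := cst 1%R) (f3 := cst 0%R)) ?expR_ge0//.
rewrite !mul0e !adde0 mul1e iL nu1 !mule1 -EFinM -expRD addNr expR0 [leRHS]addeC.
by rewrite leeD2rE.
Qed.

(** The square is expanded as [(g - 1)^2 + 2 g = g^2 + 1], with nonnegative terms only, so an
    infinite second moment is covered; only the finite integrals are subtracted. *)
Lemma integral_sub1_sqr :
  \int[nu]_x ((g x - 1) ^+ 2)%:E = \int[nu]_x (g x * g x)%:E - 1.
Proof.
have : \int[nu]_x (1 * (g x - 1) ^+ 2 + 2 * g x + 0 * 0)%:E =
    \int[nu]_x (1 * (g x * g x) + 1 * 1 + 0 * 0)%:E.
  by apply: eq_integral => x _; congr (_%:E); ring.
rewrite (integral3 _ _ _ _ (f3 := cst 0%R))//; last 2 first.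
- by move=> x; exact: sqr_ge0.
- by apply: measurable_funX; exact: measurable_funB.
rewrite (integral3 _ _ _ _ (f2 := cst 1%R) (f3 := cst 0%R))//; last 2 first.
- by move=> x; rewrite mulr_ge0.
- exact: measurable_funM.
rewrite !mul0e !adde0 !mul1e g1 nu1 mule1 => e.
have -> : \int[nu]_x (g x * g x)%:E = \int[nu]_x ((g x - 1) ^+ 2)%:E + 2%:E - 1.
  by rewrite e addeK.
rewrite -[_ + 2%:E - 1]addeA -EFinB -addeA -EFinB.
by rewrite (_ : (2 - 1 - 1)%R = 0%R) ?adde0//; lra.
Qed.

End entropy.

Section cauchy_schwarz.
Context d (T : measurableType d) (R : realType) (mu : {measure set T -> \bar R}).

Lemma integral_cauchy_schwarz (u v : T -> R) :
  measurable_fun [set: T] u -> measurable_fun [set: T] v ->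
  (forall x, (0 <= u x)%R) -> (forall x, (0 <= v x)%R) ->
  \int[mu]_x (u x * v x)%:E <=
  (\int[mu]_x (u x ^+ 2)%:E) `^ 2^-1 * (\int[mu]_x (v x ^+ 2)%:E) `^ 2^-1.
Proof.
move=> mmu mv u0 v0.
have half : (2^-1 + 2^-1 = 1 :> R)%R by lra.
have := hoelder mu mmu mv (ltr0Sn R 1) (ltr0Sn R 1) half.
rewrite Lnorm1 unlock /=.
rewrite (eq_integral (fun x => (u x * v x)%:E)); last first.
  by move=> x _ /=; rewrite ger0_norm// mulr_ge0.
have sqE (w : T -> R) : (forall x, (0 <= w x)%R) ->
    \int[mu]_x (`|w x| `^ 2)%:E = \int[mu]_x (w x ^+ 2)%:E.
  by move=> w0; apply: eq_integral => x _; rewrite ger0_norm// powR_mulrn.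
by rewrite !sqE.
Qed.

End cauchy_schwarz.

(** * Divergences as integrals of the density *)

Section divergences.
Context (R : realType) (d : nat).
Local Notation E := (borelRn R d).
Variables (nu pi : probability E R) (g : E -> R).
Hypotheses (g0 : forall x, (0 <= g x)%R) (mg : measurable_fun [set: E] g).
Hypothesis pi_g : forall f : E -> \bar R, (forall x, 0 <= f x) ->
  measurable_fun [set: E] f -> \int[pi]_x f x = \int[nu]_x (f x * (g x)%:E).
Hypothesis pinu : pi `<< nu.
Hypothesis g_dRN : ae_eq nu setT (EFin \o g) (dRN pi nu).

Let g1 : \int[nu]_x (g x)%:E = 1 := integral_density1 pi_g.

Let mdRN : measurable_fun [set: E] (dRN pi nu).
Proof. by apply: (measurable_int nu); apply: Radon_Nikodym_integrable. Qed.

Let mgE : measurable_fun [set: E] (EFin \o g).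
Proof. exact/measurable_EFinP. Qed.

Let pi_ae : ae_eq pi setT (EFin \o g) (dRN pi nu).
Proof. exact: null_dominates_ae_eq g_dRN. Qed.

(** This is the chi-square divergence. As [pi] is dominated by [nu], [g] represents the derivative
    [pi]-almost everywhere too, and [lne] is inverted by [expeR] on all of [[0, +oo]]. *)
Lemma expeR_D2_sub1 :
  expeR (D2 pi nu) - 1 = \int[nu]_x ((g x - 1) ^+ 2)%:E.
Proof.
rewrite integral_sub1_sqr// /D2.
have -> : \int[pi]_t dRN pi nu t = \int[nu]_x (g x * g x)%:E.
  rewrite (ae_eq_integral (EFin \o g))//; last exact: ae_eq_sym.
  by rewrite pi_g.
by rewrite lneK// in_itv/= leey andbT; apply: integral_ge0 => x _;
  rewrite lee_fin mulr_ge0.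
Qed.

(** The integral in [KL] is the difference of those of the positive and negative parts, which become
    [P] and [N] under [nu]. Since [u ln u >= u - 1 >= -1], [N] is bounded by 1, so the difference is
    well behaved even for infinite [KL]. *)
Lemma integral_rel_entr_KL : \int[nu]_x (rel_entr (g x))%:E = KL pi nu.
Proof.
rewrite /KL.
have mlg : measurable_fun [set: E] (fun x => lne (g x)%:E).
  by apply: measurableT_comp mgE; exact: measurable_lne.
have -> : \int[pi]_t lne (dRN pi nu t) = \int[pi]_t lne (g t)%:E.
  apply: ae_eq_integral => //.
    by apply: measurableT_comp mdRN; exact: measurable_lne.
  by apply: filterS pi_ae => x /= /(_ Logic.I) <-.
pose P x := Num.max (g x * ln (g x))%R 0%R.
pose N x := Num.max (- (g x * ln (g x)))%R 0%R.
rewrite [RHS]integralE.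
have mgln : measurable_fun [set: E] (fun x => g x * ln (g x))%R.
  by apply: measurable_funM => //; apply: measurableT_comp mg; exact: measurable_ln.
have mP : measurable_fun [set: E] P by exact: measurable_maxr.
have mN : measurable_fun [set: E] N.
  by apply: measurable_maxr => //; exact: measurableT_comp.
have P0 x : (0 <= P x)%R by rewrite le_max lexx orbT.
have N0 x : (0 <= N x)%R by rewrite le_max lexx orbT.
have gpos x : (g x <= 0)%R -> g x = 0%R.
  by move=> gx; apply/eqP; rewrite eq_le gx g0.
have -> : \int[pi]_x (fun x => lne (g x)%:E)^\+ x = \int[nu]_x (P x)%:E.
  rewrite pi_g//; last exact: measurable_funepos.
  apply: eq_integral => x _; rewrite funeposE /P /=; case: ifPn => [/gpos ->|gx].
    by rewrite mul0r maxxx mule0.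
  rewrite -[in LHS]EFin_max -EFinM; congr (_%:E).
  by rewrite maxr_pMl// mul0r mulrC.
(* Where [g x = 0] the negative part of the logarithm is [+oo], and the factor [g x] kills it by
   [+oo * 0 = 0]. *)
have -> : \int[pi]_x (fun x => lne (g x)%:E)^\- x = \int[nu]_x (N x)%:E.
  rewrite pi_g//; last exact: measurable_funeneg.
  apply: eq_integral => x _; rewrite funenegE /N /=; case: ifPn => [/gpos ->|gx].
    by rewrite mul0r oppr0 maxxx mule0.
  rewrite -EFinN -[in LHS]EFin_max -EFinM; congr (_%:E).
  by rewrite maxr_pMl// mul0r mulNr mulrC.
have Nle1 x : (N x <= 1)%R.
  have := rel_entr_ge0 (g0 x); rewrite /rel_entr ge_max ler01 andbT.
  by have := g0 x; lra.
have nu1 : \int[nu]_x 1%:E = 1 :> \bar R.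
  have := @integral_cst _ _ _ nu setT measurableT 1.
  by rewrite mul1e => ->; exact: probability_setT.
have Nfin : \int[nu]_x (N x)%:E \is a fin_num.
  rewrite ge0_fin_numE ?integral_ge0//; last by move=> x _; rewrite lee_fin.
  apply: (@le_lt_trans _ _ 1); last exact: ltry.
  rewrite -nu1; apply: ge0_le_integral => //.
  - by move=> x _; rewrite lee_fin.
  - exact/measurable_EFinP.
  - by move=> x _; rewrite lee_fin.
have mrel : measurable_fun [set: E] (fun x => rel_entr (g x)).
  by apply: measurableT_comp mg; exact: measurable_rel_entr.
(* [rel_entr g = (P - N) - g + 1], rearranged so that each side is a sum of nonnegative terms and
   can be integrated termwise. *)
have balance : \int[nu]_x ((rel_entr (g x))%:E + ((N x)%:E + (g x)%:E)) =
    \int[nu]_x ((P x)%:E + 1%:E).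
  apply: eq_integral => x _; rewrite -!EFinD; congr (_%:E).
  rewrite /P /N /rel_entr; set y := (g x * _)%R; case: (leP y 0%R) => y0.
    by rewrite max_l; lra.
  by rewrite max_r; lra.
move: balance.
have rel0 x : 0 <= (rel_entr (g x))%:E by rewrite lee_fin rel_entr_ge0.
rewrite ge0_integralD//; last 3 first.
- exact/measurable_EFinP.
- by move=> x _; rewrite -EFinD lee_fin addr_ge0.
- by apply: emeasurable_funD => //; exact/measurable_EFinP.
rewrite ge0_integralD//; last 3 first.
- by move=> x _; rewrite lee_fin.
- exact/measurable_EFinP.
- by move=> x _; rewrite lee_fin.
rewrite ge0_integralD//; last 2 first.
- by move=> x _; rewrite lee_fin.
- exact/measurable_EFinP.
rewrite g1 nu1 addeA => /(congr1 (fun z => z - 1)); rewrite !addeK// => <-.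
by rewrite addeK.
Qed.

End divergences.

(** * Wasserstein bounds *)

Section wasserstein_bounds.
Context (R : realType) (d : nat).
Local Notation E := (borelRn R d).
Variables (nu pi : probability E R) (g : E -> R).
Hypotheses (g0 : forall x, (0 <= g x)%R) (mg : measurable_fun [set: E] g).
Hypothesis pi_g : forall f : E -> \bar R, (forall x, 0 <= f x) ->
  measurable_fun [set: E] f -> \int[pi]_x f x = \int[nu]_x (f x * (g x)%:E).

Variable p : R.
Hypothesis p1 : (1 <= p)%R.

Let p0 : (0 < p)%R. Proof. exact: lt_le_trans p1. Qed.

Let mabs : measurable_fun [set: E] (fun x => `|g x - 1|%R).
Proof. by apply: measurableT_comp => //; exact: measurable_funB. Qed.

Lemma dist2_powR_triangle (q : R) (x y t : 'rV[R]_d) : (1 <= q)%R ->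
  (dist2 x y `^ q <= 2 `^ (q - 1) * (dist2 x t `^ q + dist2 y t `^ q))%R.
Proof.
move=> q1; apply: le_trans (powR_addr_le (dist2_ge0 _ _) (dist2_ge0 _ _) q1).
apply: ge0_ler_powR; rewrite ?nnegrE ?addr_ge0 ?dist2_ge0//.
  exact: le_trans q1.
by rewrite [dist2 y t]dist2C; exact: dist2_triangle.
Qed.

Lemma wasserstein_le_weighted (t : E) : wasserstein p nu pi <=
  ((2 `^ (p - 1))%:E * \int[nu]_x (dist2 x t `^ p * `|g x - 1|)%:E) `^ p^-1.
Proof.
have [gamma [gamma1 gamma2 cost]] := exists_overlap_coupling g0 mg pi_g.
apply: (@le_trans _ _ ((\int[gamma]_z (dist2 z.1 z.2 `^ p)%:E) `^ p^-1)).
  by apply: ereal_inf_lbound; exists gamma.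
apply: gt0_ler_poweR; rewrite ?in_itv/= ?leey ?andbT ?invr_ge0 ?(ltW p0)//.
- by apply: integral_ge0 => z _; rewrite lee_fin powR_ge0.
- rewrite mule_ge0 ?lee_fin ?powR_ge0//.
  by apply: integral_ge0 => z _; rewrite lee_fin mulr_ge0// powR_ge0.
have mt := measurable_dist2_powR p t.
rewrite -ge0_integralZl ?lee_fin ?powR_ge0//; last 2 first.
- by apply/measurable_EFinP; exact: measurable_funM.
- by move=> z _; rewrite lee_fin mulr_ge0// powR_ge0.
(* The cost [dist2 ^ p] vanishes on the diagonal and is split by the triangle inequality through the
   centre [t]. *)
apply: le_trans (cost _ (fun x => 2 `^ (p - 1) * dist2 x t `^ p)%R _ _ _ _ _ _) _.
- apply: (measurableT_comp (measurable_powR p)); exact: measurable_dist2.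
- exact: measurable_funM.
- by move=> z; exact: powR_ge0.
- by move=> x; rewrite mulr_ge0// powR_ge0.
- by move=> x /=; rewrite dist2_xx powR0// gt_eqF.
- by move=> x y /=; rewrite -mulrDr; exact: dist2_powR_triangle.
rewrite le_eqVlt; apply/orP; left; apply/eqP.
by apply: eq_integral => x _; rewrite -EFinM mulrA.
Qed.

Lemma wasserstein_eq0_of_weighted (t : E) :
  \int[nu]_x (dist2 x t `^ p * `|g x - 1|)%:E = 0 -> wasserstein p nu pi <= 0.
Proof.
move=> h; apply: le_trans (wasserstein_le_weighted t) _.
by rewrite h mule0 poweR0r// invr_eq0 gt_eqF.
Qed.

(** Settles the case of a vanishing divergence, where the right-hand side is 0 even if the moment
    constant is infinite. Any centre serves. *)
Lemma wasserstein_eq0_of_tv :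
  \int[nu]_x (`|g x - 1|)%:E = 0 -> wasserstein p nu pi <= 0.
Proof.
move=> h; apply: (@wasserstein_eq0_of_weighted (0%R : 'rV[R]_d)).
under eq_integral do rewrite mulrC.
apply: ge0_integral_eq0_mul => //; first exact: measurable_dist2_powR.
by move=> x; exact: powR_ge0.
Qed.

(* Averaging over both variables,
   [\int \int d(x, y)^q <= 2^q \int d(x, t)^q] for every [t], so the double
   integral vanishes. *)
Lemma exists_null_center (q : R) : (1 <= q)%R ->
  (forall e : R, (0 < e)%R ->
     exists t : E, \int[nu]_x (dist2 x t `^ q)%:E <= e%:E) ->
  exists y : E, \int[nu]_x (dist2 x y `^ q)%:E = 0.
Proof.
move=> q1 small.
pose c (z : E * E) : \bar R := (dist2 z.1 z.2 `^ q)%:E.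
have c0 z : 0 <= c z by rewrite lee_fin powR_ge0.
have mc : measurable_fun [set: (E * E)%type] c.
  apply/measurable_EFinP; apply: (measurableT_comp (measurable_powR q)).
  exact: measurable_dist2.
pose F y := \int[nu]_x c (x, y).
have mF : measurable_fun [set: E] F.
  exact: (@measurable_fun_fubini_tonelli_G _ _ _ _ _ nu c mc c0).
have F0 y : 0 <= F y by exact: integral_ge0.
have FE y : F y = \int[nu]_x c (x, y) by [].
clearbody F.
have nu1 (k : \bar R) : \int[nu]_x (cst k x) = k.
  by rewrite integral_cst// -[RHS]mule1; congr (_ * _); exact: probability_setT.
have IF : \int[nu]_y F y = 0.
  apply/eqP; rewrite eq_le integral_ge0// andbT.
  apply/lee_addgt0Pr => e e0; rewrite add0e.
  have K0 : (0 < 2 `^ (q - 1) * 2 :> R)%R by rewrite mulr_gt0// powR_gt0.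
  (* The denominator is the constant in [\int F <= 2^(q - 1) (A + A)], where [A] is the moment about
     [t]. *)
  have [t ht] := small (e / (2 `^ (q - 1) * 2))%R (divr_gt0 e0 K0).
  set A := \int[nu]_x _ in ht.
  have mt := measurable_dist2_powR q t.
  have pow0 x : 0 <= (dist2 x t `^ q)%:E by rewrite lee_fin powR_ge0.
  have A0 : 0 <= A by exact: integral_ge0.
  have Fle y : F y <= (2 `^ (q - 1))%:E * (A + (dist2 y t `^ q)%:E).
    rewrite -[X in _ + X]nu1 -ge0_integralD//; last 2 first.
    - exact/measurable_EFinP.
    - by move=> x _; rewrite lee_fin powR_ge0.
    rewrite -ge0_integralZl//; last 2 first.
    - by apply: emeasurable_funD => //; exact/measurable_EFinP.
    - by move=> x _; rewrite adde_ge0 ?lee_fin ?powR_ge0.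
    rewrite FE; apply: ge0_le_integral => //.
    - exact: measurableT_comp mc (@pair2_measurable _ _ E E y).
    - apply: emeasurable_funM => //; apply: emeasurable_funD => //.
      exact/measurable_EFinP.
    - move=> x _ /=; rewrite -EFinD -EFinM lee_fin.
      exact: (dist2_powR_triangle x y t q1).
  apply: (@le_trans _ _
      (\int[nu]_y ((2 `^ (q - 1))%:E * (A + (dist2 y t `^ q)%:E)))).
    apply: ge0_le_integral => //.
    apply: emeasurable_funM => //; apply: emeasurable_funD => //.
    exact/measurable_EFinP.
  rewrite ge0_integralZl//; last 2 first.
  - by apply: emeasurable_funD => //; exact/measurable_EFinP.
  - by move=> x _; rewrite adde_ge0.
  rewrite ge0_integralD//; last exact/measurable_EFinP.
  rewrite (_ : \int[nu]_x A = A); last exact: nu1.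
  rewrite -/A; clearbody A.
  have Afin : A \is a fin_num.
    by rewrite ge0_fin_numE//; apply: le_lt_trans ht _; exact: ltry.
  move: ht; rewrite -(fineK Afin) -EFinD -EFinM !lee_fin.
  by rewrite ler_pdivlMr//; lra.
have F_ae : ae_eq nu setT F (cst 0).
  apply/ae_eq_integral_abs => //; rewrite -IF.
  by apply: eq_integral => y _; rewrite gee0_abs.
(* [F] vanishes almost everywhere, hence somewhere: otherwise the whole space would be a null set of
   the probability [nu]. *)
apply: contrapT => /forallNP noy.
have [N [mN N0 FN]] := F_ae.
have : nu setT = 0.
  apply: (subset_measure0 _ mN _ N0) => // y _; apply: FN => /= /(_ Logic.I) Fy0.
  by apply: (noy y); rewrite -[LHS]/(\int[nu]_x c (x, y)) -FE.
move=> nu0; have := probability_setT nu.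
by rewrite nu0 => /eqP; rewrite eq_sym onee_eq0.
Qed.

(** A vanishing moment about [y] means that [nu] is concentrated where [dist2 x y = 0], so the
    weighted integral about [y] vanishes as well. *)
Lemma wasserstein_eq0_of_null_center (q : R) (y : E) : (0 < q)%R ->
  \int[nu]_x (dist2 x y `^ q)%:E = 0 -> wasserstein p nu pi <= 0.
Proof.
move=> q0 iy; apply: (@wasserstein_eq0_of_weighted y).
have mq := measurable_dist2_powR q y; have mp := measurable_dist2_powR p y.
have ae0 : ae_eq nu setT (fun x => (dist2 x y `^ q)%:E) (cst 0).
  apply/ae_eq_integral_abs => //; first exact/measurable_EFinP.
  rewrite -iy; apply: eq_integral => x _ /=.
  by rewrite ger0_norm// powR_ge0.
rewrite (@ge0_ae_eq_integral _ _ _ _ _ _ (cst 0)) ?integral0//.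
- by apply/measurable_EFinP; exact: measurable_funM.
- by move=> x _; rewrite lee_fin mulr_ge0// powR_ge0.
- apply: filterS ae0 => x /= /(_ Logic.I) [/eqP]; rewrite powR_eq0.
  by move=> /andP[/eqP -> _] _; rewrite powR0 ?mul0r// gt_eqF.
Qed.

End wasserstein_bounds.

(* With [0 * +oo = 0] the right-hand side vanishes as soon as one factor does,
   whence the two degenerate hypotheses. *)
Lemma le_scaled_ereal_inf (R : realType) (W K : \bar R) (S : set (\bar R)) :
  0 <= K -> (forall s, S s -> 0 <= s) ->
  (K = 0 -> W <= 0) -> (ereal_inf S = 0 -> W <= 0) ->
  (forall s, S s -> 0 < K < +oo -> W <= 2%:E * s * K) ->
  W <= 2%:E * ereal_inf S * K.
Proof.
move=> K0 S0 WK WS WSK.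
have i0 : 0 <= ereal_inf S by apply: le_ereal_inf_tmp => s /S0.
have [k0|k0] := eqVneq K 0; first by rewrite k0 mule0 WK.
have [s0|s0] := eqVneq (ereal_inf S) 0; first by rewrite s0 mule0 mul0e WS.
have {}k0 : 0 < K by rewrite lt_neqAle eq_sym k0.
have {}s0 : 0 < ereal_inf S by rewrite lt_neqAle eq_sym s0.
have [->|kfin] := eqVneq K +oo; first by rewrite gt0_muley ?leey// mule_gt0.
have {}kfin : 0 < K < +oo by rewrite k0 ltey.
have Kfin : K \is a fin_num by rewrite ge0_fin_numE//; case/andP: kfin.
have Kr : (0 < 2 * fine K)%R by rewrite mulr_gt0// fine_gt0.
rewrite muleAC -(fineK Kfin) -EFinM.
rewrite -lee_pdivrMl//; apply: le_ereal_inf_tmp => s Ss.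
by rewrite lee_pdivrMl// EFinM (fineK Kfin) muleAC; exact: WSK.
Qed.

Lemma le_of_root_le (R : realType) (x : \bar R) (e r : R) : 0 <= x ->
  (0 < r)%R -> (0 <= e)%R -> x `^ r^-1 <= (e `^ r^-1)%:E -> x <= e%:E.
Proof.
move=> x0 r0 e0 h; have rr : (r^-1 * r = 1)%R by rewrite mulVf// gt_eqF.
rewrite -(poweRe1 x0) -rr poweRrM -(poweRe1 (x := e%:E)) ?lee_fin// -rr poweRrM.
apply: gt0_ler_poweR; rewrite ?in_itv/= ?leey ?andbT ?poweR_ge0 ?(ltW r0)//.
by rewrite lee_fin powR_ge0.
Qed.

(** The moment of a nonnegative exponent is at least 1; when finite it thus has a real nonnegative
    logarithm. *)
Lemma exp_moment_log d (T : measurableType d) (R : realType)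
    (nu : probability T R) (phi : T -> R) :
  (forall x, (0 <= phi x)%R) -> measurable_fun [set: T] phi ->
  \int[nu]_x (expR (phi x))%:E < +oo ->
  exists2 L : R, \int[nu]_x (expR (phi x))%:E = (expR L)%:E & (0 <= L)%R.
Proof.
move=> phi0 mphi Ilty; set I := \int[nu]_x _.
have mexp : measurable_fun [set: T] (fun x => expR (phi x)).
  by apply: measurableT_comp mphi; exact: measurable_expR.
have I0 : 0 <= I by apply: integral_ge0 => x _; rewrite lee_fin expR_ge0.
have Ifin : I \is a fin_num by rewrite ge0_fin_numE.
have I1 : 1 <= I.
  have <- : \int[nu]_x (cst 1 x) = 1.
    by rewrite integral_cst// mul1e; exact: probability_setT.
  apply: ge0_le_integral => //; first exact/measurable_EFinP.
  by move=> x _; rewrite lee_fin -[X in (X <= _)%R]expR0 ler_expR.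
have IE : I = (expR (ln (fine I)))%:E.
  rewrite lnK ?fineK// posrE -lte_fin fineK//.
  by apply: lt_le_trans I1; rewrite lte_fin.
by exists (ln (fine I)) => //; apply: (log_mgf_ge0 phi0 mphi IE).
Qed.

(** * The two bounds *)

Section main.
Context (R : realType) (d : nat) (p : R).
Local Notation E := (borelRn R d).
Variables (pi nu : probability E R).
Hypotheses (p1 : (1 <= p)%R) (pinu : pi `<< nu).

Let p0 : (0 < p)%R. Proof. exact: lt_le_trans p1. Qed.

Lemma wasserstein_le_C_PI : wasserstein p nu pi
  <= C_PI (2 * p)%R nu * (expeR (D2 pi nu) - 1) `^ (2 * p)^-1%R.
Proof.
have [g [mg g0 pi_g g_dRN]] := exists_real_density pinu.
rewrite (expeR_D2_sub1 g0 mg pi_g pinu g_dRN).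
set X := \int[nu]_x _.
have X0 : 0 <= X by apply: integral_ge0 => x _; rewrite lee_fin sqr_ge0.
have p20 : (0 < 2 * p)%R by rewrite mulr_gt0.
have p21 : (1 <= 2 * p)%R by move: p1; lra.
have mabs : measurable_fun [set: E] (fun x => `|g x - 1|%R).
  by apply: measurableT_comp => //; exact: measurable_funB.
have XE : \int[nu]_x (`|g x - 1| ^+ 2)%:E = X.
  by apply: eq_integral => x _; rewrite real_normK ?num_real.
apply: le_scaled_ereal_inf.
- exact: poweR_ge0.
- by move=> _ [t _ <-]; exact: poweR_ge0.
(* Zero chi-square divergence forces [\int |g - 1| = 0], by Cauchy-Schwarz against the constant
   1. *)
- move=> /(poweR_eq0_eq0 X0) X00; apply: (wasserstein_eq0_of_tv g0 mg pi_g p1).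
  apply/eqP; rewrite eq_le integral_ge0// andbT.
  have := @integral_cauchy_schwarz _ E R nu _ (cst 1%R) mabs (measurable_cst _)
    (fun x => normr_ge0 _) (fun x => ler01).
  rewrite XE X00 poweR0r ?invr_eq0 ?pnatr_eq0// mul0e.
  by under eq_integral do rewrite mulr1.
(* A zero infimum provides centres with arbitrarily small moment, hence one with zero moment. *)
- move=> i0.
  have [e e0|y iy] := @exists_null_center _ _ nu _ p21.
    have : ereal_inf [set (\int[nu]_t (dist2 t t0 `^ (2 * p))%:E) `^ (2 * p)^-1
        | t0 in [set: E]] < (e `^ (2 * p)^-1)%:E.
      by rewrite i0 lte_fin powR_gt0.
    move=> /ereal_inf_lt[_ [t _ <-]] /ltW h; exists t.
    apply: le_of_root_le h => //; last exact: ltW.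
    by apply: integral_ge0 => x _; rewrite lee_fin powR_ge0.
  exact: (wasserstein_eq0_of_null_center g0 mg pi_g p1 p20 iy).
- move=> _ [t _ <-] _; apply: le_trans (wasserstein_le_weighted g0 mg pi_g p1 t) _.
  have mt := measurable_dist2_powR p t.
  have AE : \int[nu]_x ((dist2 x t `^ p) ^+ 2)%:E =
      \int[nu]_x (dist2 x t `^ (2 * p))%:E.
    apply: eq_integral => x _; congr (_%:E).
    by rewrite -powR_mulrn ?powR_ge0// -powRrM mulrC.
  have := @integral_cauchy_schwarz _ E R nu _ _ mt mabs
    (fun x => powR_ge0 _ _) (fun x => normr_ge0 _).
  rewrite XE AE; set A := \int[nu]_x (dist2 x t `^ (2 * p))%:E.
  have A0 : 0 <= A by apply: integral_ge0 => x _; rewrite lee_fin powR_ge0.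
  set J := \int[nu]_x _ => JAX.
  have J0 : 0 <= J.
    by apply: integral_ge0 => x _; rewrite lee_fin mulr_ge0// powR_ge0.
  have c0 : 0 <= (2 `^ (p - 1))%:E :> \bar R by rewrite lee_fin powR_ge0.
  have AX0 : 0 <= A `^ 2^-1 * X `^ 2^-1 by rewrite mule_ge0// poweR_ge0.
  apply: (@le_trans _ _ (((2 `^ (p - 1))%:E * (A `^ 2^-1 * X `^ 2^-1)) `^ p^-1)).
    apply: gt0_ler_poweR; rewrite ?in_itv/= ?leey ?andbT ?invr_ge0 ?(ltW p0)//.
    - exact: mule_ge0.
    - exact: mule_ge0.
    - exact: lee_wpmul2l.
  rewrite poweRM// poweRM ?poweR_ge0// -!poweRrM -invfM -muleA.
  apply: lee_wpmul2r; first by rewrite mule_ge0// poweR_ge0.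
  (* The constant left is [2^((p - 1) / p)], at most 2 because [(p - 1) / p <= 1]. *)
  rewrite poweR_EFin lee_fin -powRrM -[leRHS]powRr1//.
  apply: ler_powR; first lra.
  by rewrite ler_pdivrMr//; lra.
Qed.

Lemma wasserstein_le_C_EI : wasserstein p nu pi
  <= C_EI p nu * (KL pi nu `^ p^-1%R + (KL pi nu * 2^-1%:E) `^ (2 * p)^-1%R).
Proof.
have [g [mg g0 pi_g g_dRN]] := exists_real_density pinu.
have KLE := integral_rel_entr_KL g0 mg pi_g pinu g_dRN.
have g1 := integral_density1 pi_g.
have K0 : 0 <= KL pi nu.
  by rewrite -KLE; apply: integral_ge0 => x _; rewrite lee_fin rel_entr_ge0.
have pi0 : (p^-1 != 0)%R by rewrite invr_eq0 gt_eqF.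
have p2i0 : ((2 * p)^-1 != 0)%R by rewrite invr_eq0 mulf_neq0// gt_eqF.
have mphi (t : E) (c : R) : measurable_fun [set: E] (fun x => c * dist2 x t `^ p)%R.
  by apply: measurable_funM => //; exact: measurable_dist2_powR.
have phi0 (t : E) (c : R) : (0 < c)%R -> forall x : E, (0 <= c * dist2 x t `^ p)%R.
  by move=> c0 x; rewrite mulr_ge0 ?powR_ge0// ltW.
have dZ (t : E) (c : R) (w : E -> R) : (0 < c)%R ->
    measurable_fun [set: E] w -> (forall x, (0 <= w x)%R) ->
    \int[nu]_x (c * dist2 x t `^ p * w x)%:E =
    c%:E * \int[nu]_x (dist2 x t `^ p * w x)%:E.
  move=> c0 mw w0; rewrite -ge0_integralZl ?lee_fin ?(ltW c0)//.
  - by apply: eq_integral => x _; rewrite -EFinM mulrA.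
  - apply/measurable_EFinP; apply: measurable_funM => //.
    exact: measurable_dist2_powR.
  - by move=> x _; rewrite lee_fin mulr_ge0 ?powR_ge0.
have mabs : measurable_fun [set: E] (fun x => `|g x - 1|%R).
  by apply: measurableT_comp => //; exact: measurable_funB.
apply: le_scaled_ereal_inf.
- by rewrite adde_ge0// poweR_ge0.
- by move=> _ [te _ <-]; exact: poweR_ge0.
- move=> /eqP; rewrite padde_eq0 ?poweR_ge0// => /andP[/eqP + _].
  move=> /(poweR_eq0_eq0 K0) KL0; apply: (wasserstein_eq0_of_tv g0 mg pi_g p1).
  by apply: integral_abs_sub1_eq0 => //; rewrite KLE.
- move=> i0.
  (* A pair [(t, eps)] of value below [e^(1/p)] has a finite exponential moment, and Jensen bounds
     the [p]-th moment about [t] by [L / eps <= (3/2 + L) / eps <= e]. *)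
  have [e e0|y iy] := @exists_null_center _ _ nu _ p1; last first.
    exact: (wasserstein_eq0_of_null_center g0 mg pi_g p1 p0 iy).
  have : (0 : \bar R) < (e `^ p^-1)%:E by rewrite lte_fin powR_gt0.
  rewrite -[X in X < _]i0 => /ereal_inf_lt[_ [[t eps] /= eps0 <-]] /ltW h.
  exists t; move: h.
  have [Ilty|] := ltP (\int[nu]_x (expR (eps * dist2 x t `^ p))%:E) +oo; last first.
    rewrite leye_eq => /eqP ->; rewrite /= addey// gt0_muley ?lte_fin ?invr_gt0//.
    by rewrite poweRyr// leye_eq.
  have [L IL L0] := exp_moment_log (phi0 t eps eps0) (mphi t eps) Ilty.
  rewrite IL lne_EFin ?expR_gt0// expRK -EFinD -EFinM => h.
  have ML : (0 <= eps^-1 * (3 / 2 + L))%R.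
    by rewrite mulr_ge0 ?invr_ge0 ?(ltW eps0)//; lra.
  have {}h := le_of_root_le (ML : 0 <= (eps^-1 * (3 / 2 + L))%:E) p0 (ltW e0) h.
  have := integral_le_lne_integral_expR (phi0 t eps eps0) (mphi t eps) IL.
  have := dZ t eps (cst 1%R) eps0 (measurable_cst _) (fun x => ler01).
  under eq_integral do rewrite mulr1.
  under [in X in _ = X -> _]eq_integral do rewrite mulr1.
  move=> ->; rewrite -lee_pdivlMl// => /le_trans; apply.
  rewrite -EFinM; apply: le_trans h.
  rewrite lee_fin ler_wpM2l ?invr_ge0 ?(ltW eps0)//.
  by lra.
- move=> _ [[t eps] /= eps0 <-] /andP[K_gt0 K_lty].
  have KLfin : KL pi nu \is a fin_num.
    rewrite ge0_fin_numE// ltey; apply/eqP => KLy; move: K_lty.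
    by rewrite KLy poweRyr// addye ?ltxx// gt_eqF// (lt_le_trans _ (poweR_ge0 _ _)).
  have [k kE] : exists k, KL pi nu = k%:E by exists (fine (KL pi nu)); rewrite fineK.
  have k_gt0 : (0 < k)%R.
    rewrite lt_neqAle -lee_fin -kE K0 andbT eq_sym; apply/eqP => k0.
    by move: K_gt0; rewrite kE k0 mul0e !poweR0r// adde0 ltxx.
  (* An infinite exponential moment makes the right-hand side [+oo]. *)
  have [Ilty|] := ltP (\int[nu]_x (expR (eps * dist2 x t `^ p))%:E) +oo; last first.
    rewrite leye_eq => /eqP ->; rewrite /= addey// gt0_muley ?lte_fin ?invr_gt0//.
    by rewrite poweRyr// gt0_muley// gt0_mulye// leey.
  have [L IL L0] := exp_moment_log (phi0 t eps eps0) (mphi t eps) Ilty.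
  rewrite IL lne_EFin ?expR_gt0// expRK -EFinD -EFinM.
  have := weighted_pinsker g0 mg g1 (phi0 t eps eps0) (mphi t eps) IL k_gt0.
  rewrite KLE kE lexx => /(_ isT).
  rewrite dZ// -lee_pdivlMl// -EFinM => J_le.
  apply: le_trans (wasserstein_le_weighted g0 mg pi_g p1 t) _.
  set r := (k + Num.sqrt (k / 2))%R in J_le.
  set M := (3 / 2 + L)%R in J_le *.
  have r0 : (0 <= r)%R by rewrite addr_ge0 ?sqrtr_ge0// ltW.
  have M0 : (0 <= eps^-1 * M)%R by rewrite mulr_ge0 ?invr_ge0 ?(ltW eps0)// addr_ge0.
  (* The factor 2 of [weighted_pinsker] turns [2^(p - 1)] into [2^p], whose [p]-th root is the
     factor 2 in [C_EI]. *)
  apply: (@le_trans _ _ ((2 `^ p * (eps^-1 * M) * r)%:E `^ p^-1)).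
    apply: gt0_ler_poweR; rewrite ?in_itv/= ?leey ?andbT ?invr_ge0 ?(ltW p0)//.
    - rewrite mule_ge0 ?lee_fin ?powR_ge0//.
      by apply: integral_ge0 => x _; rewrite lee_fin mulr_ge0// powR_ge0.
    - by rewrite lee_fin mulr_ge0// mulr_ge0// powR_ge0.
    apply: (@le_trans _ _ ((2 `^ (p - 1))%:E * (eps^-1 * (2 * M * r))%:E)).
      by rewrite lee_wpmul2l ?lee_fin ?powR_ge0.
    rewrite -EFinM lee_fin le_eqVlt; apply/orP; left; apply/eqP.
    rewrite powRB ?pnatr_eq0 ?implybT// powRr1//; field.
    by rewrite gt_eqF.
  rewrite -[k%:E * _]EFinM !poweR_EFin -EFinD -!EFinM lee_fin.
  have p20 : (0 <= 2 `^ p :> R)%R by rewrite powR_ge0.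
  have q0 : (0 <= 2 `^ p * (eps^-1 * M))%R by rewrite mulr_ge0.
  rewrite (powRM _ q0 r0) (powRM _ p20 M0) -powRrM divff ?gt_eqF// powRr1//.
  rewrite ler_wpM2l ?mulr_ge0 ?powR_ge0//.
  have k20 : (0 <= k / 2)%R by rewrite divr_ge0// ltW.
  have pin : (0 < p^-1 <= 1)%R by rewrite invr_gt0 p0 invf_le1.
  (* The root of [k + sqrt (k / 2)] is split here, and the root of [sqrt (k / 2)] is the power
     [1 / (2 p)] of [k / 2]. *)
  apply: le_trans (powR_subadditive (ltW k_gt0) (sqrtr_ge0 _) pin) _.
  by rewrite -powR12_sqrt// -powRrM invfM.
Qed.

End main.

Theorem proposition4p2 (R : realType) (d : nat) (p : R) (hp : (1 <= p)%R)
    (pi pihat : probability (borelRn R d) R) (hac : pi `<< pihat) :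
  wasserstein p pihat pi
    <= C_PI (2 * p)%R pihat * (expeR (D2 pi pihat) - 1) `^ (2 * p)^-1%R
  /\
  wasserstein p pihat pi
    <= C_EI p pihat *
       (KL pi pihat `^ p^-1%R + (KL pi pihat * 2^-1%:E) `^ (2 * p)^-1%R).
Proof.
by split; [exact: wasserstein_le_C_PI|exact: wasserstein_le_C_EI].
Qed.
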